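(* Let $n\geq 2$ and write any $A\in\mathbb{C}^{n\times n}$ as $A=[a_{j,k}]$. Define \[ \widetilde{\Omega}_{1,n}:=\{A\in\Omega_{1,n} : \widehat{A}\text{ is non-derogatory and } (a_{2,1},\dots,a_{n,1})^T \text{ is a cyclic vector of } \widehat{A}\}. \] Then: (1) The set $\mathfrak{S}_{1,n}:=\Omega_{1,n}\setminus\widetilde{\Omega}_{1,n}$ has zero Lebesgue measure in $\mathbb{C}^{n\times n}\cong\mathbb{R}^{2n^2}$. (2) The map $\pi_n$ is holomorphic and maps $\Omega_{1,n}$ onto $\mathbb{G}_{1,n}$. (3) Let $\zeta_1,\dots,\zeta_M$ be distinct points of $\mathbb{D}$ and let $W_1,\dots,W_M\in\widetilde{\Omega}_{1,n}$. Then there exists a holomorphic map $F:\mathbb{D}\to\Omega_{1,n}$ with $F(\zeta_j)=W_j$ for all $j\le M$ if and only if there exists a holomorphic map $f:\mathbb{D}\to\mathbb{G}_{1,n}$ with $f(\zeta_j)=\pi_n(W_j)$ for all $j\le M$.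
   Context: $\mathbb{D}$ is the open unit disc in $\mathbb{C}$. For $A\in\mathbb{C}^{n\times n}$, $\widehat{A}$ denotes the $(n-1)\times(n-1)$ matrix obtained by deleting the first row and first column of $A$. For $1\le j\le n$, $\mathscr{I}^j$ is the set of increasing $j$-tuples $I=(i_1<\dots<i_j)$ in $\{1,\dots,n\}^j$, and $A_I$ is the $j\times j$ submatrix of $A$ with rows and columns indexed by $I$. A square matrix $X\in\mathbb{C}^{k\times k}$ is non-derogatory if it has a cyclic vector, i.e. a $v$ with $v,Xv,\dots,X^{k-1}v$ spanning $\mathbb{C}^k$. Structured singular value: for a linear subspace $E\subseteq\mathbb{C}^{n\times n}$, $\mu_E(A):=\big(\inf\{\|X\|: X\in E,\ \mathbb{I}-AX \text{ singular}\}\big)^{-1}$, where $\|\cdot\|$ is the operator norm for the Euclidean norm. Let $E^{1,n}:=\{[w]\oplus(z\mathbb{I}_{n-1}): z,w\in\mathbb{C}\}$ and $\Omega_{1,n}:=\{A\in\mathbb{C}^{n\times n}:\mu_{E^{1,n}}(A)<1\}$. For $(x,y)\in\mathbb{C}^n\times\mathbb{C}^{n-1}$ let $P_n(z;x):=\sum_{j=0}^{n-1}(-1)^jx_{j+1}z^j$ and $Q_n(z;y):=1+\sum_{j=1}^{n-1}(-1)^jy_jz^j$. The $\mu_{1,n}$-quotient is $\mathbb{G}_{1,n}:=\{(x,y)\in\mathbb{C}^n\times\mathbb{C}^{n-1}: \text{the zero set in }\mathbb{C}^2\text{ of }(z,w)\mapsto Q_n(z;y)-wP_n(z;x)\text{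 does not meet }\overline{\mathbb{D}}^2\}$. The map $\pi_n:\mathbb{C}^{n\times n}\to\mathbb{C}^n\times\mathbb{C}^{n-1}$ is $\pi_n(A)=(X(A),Y(A))$ with $X_1(A)=a_{1,1}$, $X_j(A)=\sum_{I\in\mathscr{I}^j: i_1=1}\det(A_I)$ for $2\le j\le n$, and $Y_j(A)=\sum_{I\in\mathscr{I}^j: i_1\ge2}\det(A_I)$ for $1\le j\le n-1$. *)

(* Defs.v *)
From Stdlib Require Import Reals Lra Psatz ClassicalEpsilon FunctionalExtensionality.

Record C : Type := mkC { re : R; im : R }.

Definition C0 : C := mkC R0 R0.
Definition C1 : C := mkC R1 R0.
Definition Cadd (a b : C) : C := mkC (re a + re b)%R (im a + im b)%R.
Definition Copp (a : C) : C := mkC (- re a)%R (- im a)%R.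
Definition Cmul (a b : C) : C :=
  mkC (re a * re b - im a * im b)%R (re a * im b + im a * re b)%R.
Definition Cinv (a : C) : C :=
  mkC (re a / (re a * re a + im a * im a))%R
      (- im a / (re a * re a + im a * im a))%R.

Local Open Scope R_scope.

Lemma C_ext (a b : C) : re a = re b -> im a = im b -> a = b.
Proof. destruct a, b; simpl; intros; subst; reflexivity. Qed.

Lemma CaddA_ (a b c : C) : Cadd a (Cadd b c) = Cadd (Cadd a b) c.
Proof. apply C_ext; simpl; ring. Qed.
Lemma CaddC_ (a b : C) : Cadd a b = Cadd b a.
Proof. apply C_ext; simpl; ring. Qed.
Lemma Cadd0_ (a : C) : Cadd C0 a = a.
Proof. apply C_ext; simpl; ring. Qed.
Lemma CaddN_ (a : C) : Cadd (Copp a) a = C0.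
Proof. apply C_ext; simpl; ring. Qed.
Lemma CmulA_ (a b c : C) : Cmul a (Cmul b c) = Cmul (Cmul a b) c.
Proof. apply C_ext; simpl; ring. Qed.
Lemma CmulC_ (a b : C) : Cmul a b = Cmul b a.
Proof. apply C_ext; simpl; ring. Qed.
Lemma Cmul1_ (a : C) : Cmul C1 a = a.
Proof. apply C_ext; simpl; ring. Qed.
Lemma CmulDl_ (a b c : C) : Cmul (Cadd a b) c = Cadd (Cmul a c) (Cmul b c).
Proof. apply C_ext; simpl; ring. Qed.
Lemma C1_neq0_ : C1 <> C0.
Proof. intro H. injection H. lra. Qed.
Lemma CmulV_ (a : C) : a <> C0 -> Cmul (Cinv a) a = C1.
Proof.
  intro Ha. destruct a as [x y]; simpl.
  assert (Hn : x * x + y * y <> 0).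
  { intro H0. apply Ha. assert (x = 0) by nra. assert (y = 0) by nra.
    subst; reflexivity. }
  apply C_ext; simpl; field; exact Hn.
Qed.
Lemma Cinv0_ : Cinv C0 = C0.
Proof. apply C_ext; simpl; unfold Rdiv; ring. Qed.

Close Scope R_scope.

Definition C_eqb (a b : C) : bool :=
  if excluded_middle_informative (a = b) then true else false.

Definition C_find (P : C -> bool) (n : nat) : option C :=
  match excluded_middle_informative (exists x, P x = true) with
  | left H => Some (proj1_sig (constructive_indefinite_description _ H))
  | right _ => None
  end.

From HB Require Import structures.
From mathcomp Require Import all_boot all_order all_algebra.

Set Implicit Arguments.
Unset Strict Implicit.
Unset Printing Implicit Defensive.

Lemma C_eqP : Equality.axiom C_eqb.
Proof.
  move=> a b; rewrite /C_eqb.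
  case: (excluded_middle_informative (a = b)) => H; [exact: ReflectT | exact: ReflectF].
Qed.

HB.instance Definition _ := hasDecEq.Build C C_eqP.

Lemma C_find_some (P : pred C) n x : C_find P n = Some x -> P x.
Proof.
  rewrite /C_find.
  case: (excluded_middle_informative _) => // H [<-].
  exact: (proj2_sig (constructive_indefinite_description _ H)).
Qed.

Lemma C_find_ex (P : pred C) : (exists x, P x) -> exists n, C_find P n.
Proof.
  move=> H; exists 0%N; rewrite /C_find.
  case: (excluded_middle_informative _) => // H'.
  all: by exfalso; apply: H'; case: H => x Hx; exists x.
Qed.

Lemma C_find_ext (P Q : pred C) : P =1 Q -> C_find P =1 C_find Q.
Proof.
  move=> PQ.
  have E : P = Q by apply: functional_extensionality => x; exact: PQ.
  by rewrite E.
Qed.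

HB.instance Definition _ := hasChoice.Build C C_find_some C_find_ex C_find_ext.

HB.instance Definition _ :=
  GRing.isZmodule.Build C CaddA_ CaddC_ Cadd0_ CaddN_.

Lemma C1_neq0 : C1 != C0.
Proof. by apply/eqP; exact: C1_neq0_. Qed.

HB.instance Definition _ :=
  GRing.Zmodule_isComNzRing.Build C CmulA_ CmulC_ Cmul1_ CmulDl_ C1_neq0.

Import GRing.Theory.
Local Open Scope ring_scope.

Lemma CmulVf (a : C) : a != 0 -> Cinv a * a = 1.
Proof. by move/eqP => Ha; apply: CmulV_. Qed.

HB.instance Definition _ := GRing.ComNzRing_isField.Build C CmulVf Cinv0_.

Definition Cabs2 (z : C) : R := Rplus (Rmult (re z) (re z)) (Rmult (im z) (im z)).
Definition Cabs (z : C) : R := sqrt (Cabs2 z).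

Definition vnorm (k : nat) (v : 'cV[C]_k) : R :=
  sqrt (\big[Rplus/R0]_(i < k) Cabs2 (v i ord0)).

Definition mxnorm (p q : nat) (H : 'M[C]_(p, q)) : R :=
  sqrt (\big[Rplus/R0]_(i < p) \big[Rplus/R0]_(j < q) Cabs2 (H i j)).

Definition opnorm_is (k : nat) (X : 'M[C]_k) (s : R) : Prop :=
  is_lub (fun r => exists v : 'cV[C]_k, Rle (vnorm v) R1 /\ r = vnorm (X *m v)) s.

Definition inD (z : C) : Prop := Rlt (Cabs z) R1.
Definition inDbar (z : C) : Prop := Rle (Cabs z) R1.

Definition in_E1n (k : nat) (X : 'M[C]_k) : Prop :=
  exists z w : C,
    X = \matrix_(i < k, j < k)
          (if i == j then (if (i : nat) == 0%N then w else z) else 0).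

(* mu_{E^{1,n}}(A) < 1, i.e. inf{ ||X|| : X in E, I - AX singular } > 1
   (with inf of the empty set = +infinity, i.e. mu = 0):
   some r > 1 is a lower bound of that set of operator norms. *)
Definition Omega1n (k : nat) (A : 'M[C]_k) : Prop :=
  exists r : R, Rlt R1 r /\
    forall X : 'M[C]_k, in_E1n X -> (1%:M - A *m X) \notin unitmx ->
      forall s : R, opnorm_is X s -> Rle r s.

Definition hatmx (m : nat) (A : 'M[C]_m.+1) : 'M[C]_m :=
  \matrix_(i < m, j < m) A (lift ord0 i) (lift ord0 j).

Definition firstcol_tail (m : nat) (A : 'M[C]_m.+1) : 'cV[C]_m :=
  \col_(i < m) A (lift ord0 i) ord0.

Definition cyclic_vector (k : nat) (X : 'M[C]_k) (v : 'cV[C]_k) : bool :=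
  row_full (\matrix_(i < k, j < k) ((X ^+ i *m v) j ord0)).

Definition non_derogatory (k : nat) (X : 'M[C]_k) : Prop :=
  exists v : 'cV[C]_k, cyclic_vector X v.

Definition Omega1n_tilde (m : nat) (A : 'M[C]_m.+1) : Prop :=
  Omega1n A /\ non_derogatory (hatmx A) /\ cyclic_vector (hatmx A) (firstcol_tail A).

(* principal submatrix A_I, for I an increasing tuple of indices, represented
   by its underlying set S (enumerated in increasing order) *)
Definition principal_minor (k : nat) (A : 'M[C]_k) (S : {set 'I_k}) : 'M[C]_#|S| :=
  \matrix_(a < #|S|, b < #|S|) A (enum_val a) (enum_val b).

(* X(A) in C^n, 0-indexed: coordinate j stands for X_{j+1} *)
Definition piX (m : nat) (A : 'M[C]_m.+1) : 'rV[C]_m.+1 :=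
  \row_(j < m.+1)
    (if (j : nat) == 0%N then A ord0 ord0
     else \sum_(S : {set 'I_m.+1} | (#|S| == j.+1) && (ord0 \in S))
            \det (principal_minor A S)).

(* Y(A) in C^{n-1}, 0-indexed: coordinate j stands for Y_{j+1} *)
Definition piY (m : nat) (A : 'M[C]_m.+1) : 'rV[C]_m :=
  \row_(j < m)
    \sum_(S : {set 'I_m.+1} | (#|S| == j.+1) && (ord0 \notin S))
      \det (principal_minor A S).

Definition pi_n (m : nat) (A : 'M[C]_m.+1) : 'rV[C]_m.+1 * 'rV[C]_m :=
  (piX A, piY A).

Definition Pn (m : nat) (x : 'rV[C]_m.+1) (z : C) : C :=
  \sum_(j < m.+1) (-1) ^+ j * x ord0 j * z ^+ j.

Definition Qn (m : nat) (y : 'rV[C]_m) (z : C) : C :=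
  1 + \sum_(j < m) (-1) ^+ j.+1 * y ord0 j * z ^+ j.+1.

Definition G1n (m : nat) (xy : 'rV[C]_m.+1 * 'rV[C]_m) : Prop :=
  forall z w : C, inDbar z -> inDbar w -> Qn xy.2 z - w * Pn xy.1 z != 0.

Definition Cdiff_at (g : C -> C) (z : C) : Prop :=
  exists L : C, forall eps : R, Rlt R0 eps ->
    exists delta : R, Rlt R0 delta /\
      forall h : C, Rlt R0 (Cabs h) -> Rlt (Cabs h) delta ->
        Rle (Cabs (g (z + h) - g z - L * h)) (Rmult eps (Cabs h)).

Definition holo_D (g : C -> C) : Prop := forall z, inD z -> Cdiff_at g z.

Definition holo_mx_D (p q : nat) (F : C -> 'M[C]_(p, q)) : Prop :=
  forall i j, holo_D (fun z => F z i j).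

Definition holo_pair_D (m : nat) (f : C -> 'rV[C]_m.+1 * 'rV[C]_m) : Prop :=
  holo_mx_D (fun z => (f z).1) /\ holo_mx_D (fun z => (f z).2).

Definition Cdiff_mx_at (p q : nat) (phi : 'M[C]_(p, q) -> C) (A : 'M[C]_(p, q)) : Prop :=
  exists L : 'M[C]_(p, q), forall eps : R, Rlt R0 eps ->
    exists delta : R, Rlt R0 delta /\
      forall H : 'M[C]_(p, q), Rlt (mxnorm H) delta ->
        Rle (Cabs (phi (A + H) - phi A - \sum_(i < p) \sum_(j < q) L i j * H i j))
            (Rmult eps (mxnorm H)).

Definition holo_pi_entire (m : nat)
    (pi : 'M[C]_m.+1 -> 'rV[C]_m.+1 * 'rV[C]_m) : Prop :=
  (forall (j : 'I_m.+1) A, Cdiff_mx_at (fun B => (pi B).1 ord0 j) A) /\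
  (forall (j : 'I_m) A, Cdiff_mx_at (fun B => (pi B).2 ord0 j) A).

Definition in_box (k : nat) (lo hi A : 'M[C]_k) : Prop :=
  forall i j,
    Rle (re (lo i j)) (re (A i j)) /\ Rle (re (A i j)) (re (hi i j)) /\
    Rle (im (lo i j)) (im (A i j)) /\ Rle (im (A i j)) (im (hi i j)).

Definition box_ok (k : nat) (lo hi : 'M[C]_k) : Prop :=
  forall i j, Rle (re (lo i j)) (re (hi i j)) /\ Rle (im (lo i j)) (im (hi i j)).

Definition box_vol (k : nat) (lo hi : 'M[C]_k) : R :=
  \big[Rmult/R1]_(i < k) \big[Rmult/R1]_(j < k)
     Rmult (Rminus (re (hi i j)) (re (lo i j))) (Rminus (im (hi i j)) (im (lo i j))).

Definition null_set (k : nat) (S : 'M[C]_k -> Prop) : Prop :=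
  forall eps : R, Rlt R0 eps ->
    exists lo hi : nat -> 'M[C]_k,
      (forall l, box_ok (lo l) (hi l)) /\
      (forall A, S A -> exists l, in_box (lo l) (hi l) A) /\
      (forall N, Rlt (sum_f_R0 (fun l => box_vol (lo l) (hi l)) N) eps).

(* Main.v *)
(* In block form A = [a, b; c, Ah], one has det (1 - A (w (+) z I)) = Q(z) - w P(z) with
   (P, Q) encoded by pi_n A; since the norm of w (+) z I is max (|z|, |w|), compactness of the
   closed bidisc gives Omega = pi_n^-1 (G).

   If c is cyclic for Ah and K is the matrix with columns c, Ah c, ..., then conjugating A by
   1 (+) K^-1 turns Ah into a companion matrix and c into the first basis vector. Such a matrix
   is determined polynomially by pi_n A: the companion matrix by Q, and the first row as the
   initial Taylor coefficients of P / Q. Thus (K, pi_n A) are coordinates on the cyclic A, and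
   lifting f amounts to interpolating the K_j by a holomorphic map with values in GL; this is
   done one node at a time, by Gaussian elimination, from the factors 1 + t N with N^2 = 0 and
   from scalar exponentials.

   If c is not cyclic for Ah, then some left eigenvector of Ah annihilates c. Hence the
   non-cyclic A lie in countably many Lipschitz images of boxes in a complex space of dimension
   n^2 - 1, and a grid count shows that those are null. *)
From Stdlib Require Import Reals Lra Psatz FunctionalExtensionality ClassicalEpsilon.
From Stdlib Require Cantor.
From Coquelicot Require Compactness.
Require Import Defs.
From HB Require Import structures.
From mathcomp Require Import all_boot all_order all_algebra.
(* Stdlib's tactics on R, before mathcomp's versions shadow them *)
Ltac real_ring := ring.
Ltac real_field := field.
From mathcomp Require Import perm ring.
From mathcomp Require complex Rstruct.

Set Implicit Arguments.
Unset Strict Implicit.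
Unset Printing Implicit Defensive.

Import GRing.Theory.
Local Open Scope ring_scope.

(** * Expansion of determinants along principal minors *)

(** Invertibility is the obstacle in the lifting. A matrix polynomial through prescribed invertible
    values may become singular inside the disc, just as a scalar polynomial with nonzero values at
    the nodes may vanish elsewhere. Hence only factors with an explicit entire inverse are
    multiplied, and each is the identity at all nodes but one, so that the corrections at different
    nodes do not interfere. Staying in the domain is then automatic: conjugation by [1 (+) K]
    preserves [pi_n], the canonical matrix is a section of [pi_n], and membership in [Omega1n]
    depends on [pi_n] alone. The same section gives surjectivity.

    Algebraic identities for [pi_n] are not proved on minors but on coefficients of determinants,
    through [det_pencil]. Inverses appear as adjugates of matrices of determinant 1 or as separately
    given functions, so that regularity reduces to closure under constants, sums and products. *)

Lemma det_mxsub_unit_rows (R : comNzRingType) (k p : nat) (f : 'I_p -> 'I_k)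
    (B : 'M[R]_k) :
  injective f ->
  (forall i, i \notin codom f -> forall j, B i j = (i == j)%:R) ->
  \det (mxsub f f B) = \det B.
Proof.
move: {2}(k - p)%N (erefl (k - p)%N) => d.
elim: d p f => [|d IHd] p f Ed f_inj unitB.
  have le_pk : (p <= k)%N by rewrite -[p]card_ord -[k]card_ord; apply: leq_card f_inj.
  have eq_pk : p = k by apply/eqP; rewrite eqn_leq le_pk -subn_eq0 Ed eqxx.
  subst p.
  have -> : mxsub f f B = row_perm (perm f_inj) (col_perm (perm f_inj) B).
    by apply/matrixP=> i j; rewrite !mxE !permE.
  rewrite row_permE col_permE !det_mulmx !det_perm mulrCA odd_permV.
  by rewrite -signr_addb addbb mulr1.
(* An index outside the image is put in front of [f]. Its row is a unit row, and Laplace expansion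
   along it gives back the smaller minor. The induction ends when [f] is a permutation. *)
have [i0 Hi0] : exists i0, i0 \notin codom f.
  apply/existsP; rewrite -negb_forall; apply/negP => /forallP sub.
  have : (k <= p)%N.
    rewrite -[X in (X <= _)%N]card_ord -[X in (_ <= X)%N]card_ord.
    rewrite -(card_codom f_inj); apply/subset_leq_card/subsetP => i _; exact: sub.
  by rewrite -subn_eq0 Ed.
pose f' (i : 'I_p.+1) := oapp f i0 (unlift ord0 i).
have f'0 : f' ord0 = i0 by rewrite /f' unlift_none.
have f'S i : f' (lift ord0 i) = f i by rewrite /f' liftK.
have f'_inj : injective f'.
  move=> i j; case: (unliftP ord0 i) => [i1 ->|->]; case: (unliftP ord0 j) => [j1 ->|->];
    rewrite ?f'0 ?f'S //.
  - by move/f_inj ->.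
  - by move=> E; case/negP: Hi0; rewrite -E codom_f.
  - by move=> E; case/negP: Hi0; rewrite E codom_f.
rewrite -(IHd p.+1 f') //; first last.
- move=> i Hi; apply: unitB; apply: contra Hi => /codomP[j ->].
  by rewrite -f'S codom_f.
- by move: Ed; rewrite subnS => ->.
rewrite (expand_det_row _ ord0) (bigD1 ord0) //= big1 ?addr0 => [|j j0].
  rewrite !mxE f'0 unitB // eqxx mul1r /cofactor addn0 expr0 mul1r.
  by congr (\det _); apply/matrixP=> i j; rewrite !mxE !f'S.
by rewrite !mxE f'0 unitB // -{1}f'0 (inj_eq f'_inj) eq_sym (negbTE j0) mul0r.
Qed.

(** Multilinearity in the rows: each row comes either from the diagonal matrix or from [B], and [S]
    collects those taken from [B]. *)
Lemma det_diag_add (R : comNzRingType) (k : nat) (d : 'I_k -> R) (B : 'M[R]_k) :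
  \det (\matrix_(i, j) (d i *+ (i == j) + B i j)) =
  \sum_(S : {set 'I_k}) (\prod_(i | i \notin S) d i) *
     \det (mxsub (enum_val (A := mem S)) (enum_val (A := mem S)) B).
Proof.
pose E (S : {set 'I_k}) := \matrix_(i, j) (if i \in S then B i j else (i == j)%:R) : 'M[R]_k.
have detE (S : {set 'I_k}) :
    \det (E S) = \det (mxsub (enum_val (A := mem S)) (enum_val (A := mem S)) B).
  rewrite -(@det_mxsub_unit_rows _ _ _ (enum_val (A := mem S)) (E S)) //.
  - by congr (\det _); apply/matrixP=> i j; rewrite !mxE enum_valP.
  - exact: enum_val_inj.
  - move=> i Hi j; rewrite mxE; case: ifP => // iS.
    by case/negP: Hi; rewrite -(enum_rankK_in iS iS) codom_f.
under [RHS]eq_bigr => S _ do rewrite -detE /determinant big_distrr /=.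
rewrite exchange_big; apply: eq_bigr => s _ /=.
under eq_bigr => i _ do rewrite mxE addrC.
rewrite bigA_distr big_distrr /=; apply: eq_bigr => S _.
rewrite mulrCA; congr (_ * _).
rewrite [in RHS]big_mkcond /= -big_split /=; apply: eq_bigr => i _.
rewrite mxE; case: (i \in S) => /=; first by rewrite mul1r.
by case: eqP; rewrite ?mulr1 ?mulr0.
Qed.

Lemma det_diag_sub_mul_diag (R : comNzRingType) (k : nat) (d e : 'I_k -> R) (A : 'M[R]_k) :
  \det (\matrix_(i, j) (d i *+ (i == j) - A i j * e j)) =
  \sum_(S : {set 'I_k}) (\prod_(i | i \notin S) d i) * (\prod_(i in S) - e i) *
     \det (mxsub (enum_val (A := mem S)) (enum_val (A := mem S)) A).
Proof.
have -> : \matrix_(i, j) (d i *+ (i == j) - A i j * e j) =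
          \matrix_(i, j) (d i *+ (i == j) + (\matrix_(i, j) (- (A i j * e j))) i j).
  by apply/matrixP=> i j; rewrite !mxE.
rewrite det_diag_add; apply: eq_bigr => S _; rewrite -mulrA; congr (_ * _).
pose D : 'rV[R]_#|S| := \row_i - e (enum_val i).
have -> : mxsub (enum_val (A := mem S)) (enum_val (A := mem S))
             (\matrix_(i, j) (- (A i j * e j))) =
          mxsub (enum_val (A := mem S)) (enum_val (A := mem S)) A *m diag_mx D.
  apply/matrixP=> i j; rewrite mul_mx_diag !mxE.
  by rewrite mulrN.
rewrite det_mulmx mulrC det_diag; congr (_ * _).
rewrite [RHS]big_enum_val; apply: eq_bigr => i _; by rewrite mxE.
Qed.

(** Absorbs the separate clause for the first coordinate into the general sum of minors. *)
Lemma piXE (m : nat) (A : 'M[C]_m.+1) (j : 'I_m.+1) :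
  piX A ord0 j = \sum_(S : {set 'I_m.+1} | (#|S| == j.+1) && (ord0 \in S))
                   \det (principal_minor A S).
Proof.
rewrite mxE; case: eqP => // j0; rewrite j0.
rewrite (big_pred1 [set ord0]) => [|S /=]; last first.
  apply/andP/eqP => [[/cards1P[x ->]]|->]; last by rewrite cards1 set11.
  by rewrite inE => /eqP <-.
set B := principal_minor _ _.
have -> : B = (A ord0 ord0)%:M.
  apply/matrixP=> i k; rewrite !mxE.
  have E (l : 'I_#|[set ord0 : 'I_m.+1]|) : enum_val l = ord0.
    by have := enum_valP l; rewrite inE => /eqP.
  rewrite !E; have /eqP -> : i == k; last by rewrite eqxx.
  by apply/eqP/enum_val_inj; rewrite !E.
by rewrite det_scalar cards1 expr1.
Qed.

(** The diagonal of [u (+) s I], as a function of the index. *)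
Definition split0 (T : Type) (m : nat) (u s : T) (i : 'I_m.+1) : T :=
  if i == ord0 then u else s.

Lemma prod_split0 (R : comNzRingType) (m : nat) (u s : R) (S : {set 'I_m.+1}) :
  \prod_(i in S) split0 u s i =
  (if ord0 \in S then u * s ^+ #|S|.-1 else s ^+ #|S|).
Proof.
case: ifP => S0.
  rewrite (bigD1 ord0) //= {1}/split0 eqxx; congr (_ * _).
  rewrite (eq_bigr (fun => s)) => [|i /andP[_ /negbTE i0]]; last by rewrite /split0 i0.
  rewrite (cardsD1 ord0) S0 /= -prodr_const; apply: eq_bigl => i.
  by rewrite !inE andbC.
rewrite (eq_bigr (fun => s)) => [|i iS]; first by rewrite prodr_const.
by rewrite /split0; case: eqP => // i0; rewrite -i0 iS in S0.
Qed.

(** Four weights and a general target ring let one identity serve throughout: over C it gives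
    [det (1 - A (w (+) z I))], over [{poly C}] the characteristic polynomial of [Ah], its reversal
    Q, and P. *)
Lemma det_pencil (R : comNzRingType) (phi : {rmorphism C -> R}) (m : nat)
    (A : 'M[C]_m.+1) (u s v t : R) :
  \det (\matrix_(i, j) (split0 u s i *+ (i == j) - phi (A i j) * split0 v t j)) =
  u * (s ^+ m + \sum_(j < m) (-1) ^+ j.+1 * phi (piY A ord0 j) * t ^+ j.+1 * s ^+ (m - j.+1))
  - v * \sum_(j < m.+1) (-1) ^+ j * phi (piX A ord0 j) * t ^+ j * s ^+ (m - j).
Proof.
pose detA (S : {set 'I_m.+1}) := phi (\det (principal_minor A S)).
have -> : \det (\matrix_(i, j) (split0 u s i *+ (i == j) - phi (A i j) * split0 v t j)) =
  \sum_(S : {set 'I_m.+1}) (\prod_(i in ~: S) split0 u s i) *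
       ((-1) ^+ #|S| * \prod_(i in S) split0 v t i) * detA S.
  have -> : \matrix_(i, j) (split0 u s i *+ (i == j) - phi (A i j) * split0 v t j) =
    \matrix_(i, j) (split0 u s i *+ (i == j) - (map_mx phi A) i j * split0 v t j).
    by apply/matrixP=> i j; rewrite !mxE.
  rewrite det_diag_sub_mul_diag; apply: eq_bigr => S _.
  congr (_ * _ * _).
  - by apply: eq_bigl => i; rewrite inE.
  - by rewrite prodrN.
  - rewrite /detA -det_map_mx; congr (\det _).
    by apply/matrixP=> i j; rewrite !mxE.
have cardC (S : {set 'I_m.+1}) : #|~: S| = (m.+1 - #|S|)%N.
  by rewrite cardsCs setCK card_ord.
have card_le (S : {set 'I_m.+1}) : (#|S| <= m.+1)%N.
  by apply: leq_trans (max_card _) _; rewrite card_ord.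
(* Sets avoiding index 0 contribute the factor [u] and the minors of [piY]; those containing it
   contribute [v] and the minors of [piX]. *)
rewrite (bigID (fun S : {set 'I_m.+1} => ord0 \notin S)) /=; congr (_ + _).
  under eq_bigr => S S0.
    rewrite !prod_split0 (negbTE S0) in_setC S0 cardC.
    over.
  have lt0 (S : {set 'I_m.+1}) : ord0 \notin S -> (#|S| < m.+1)%N.
    move=> S0; rewrite ltn_neqAle card_le andbT; apply: contra S0 => /eqP cS.
    have -> : S = setT by apply/eqP; rewrite eqEcard subsetT cardsT card_ord cS leqnn.
    by rewrite inE.
  (* Such a set has at most [m] elements, so [inord] keeps its size. The empty set gives the term
     [s ^+ m]. *)
  rewrite (partition_big (fun S : {set 'I_m.+1} => inord #|S|) (fun _ : 'I_m.+1 => true)) //=.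
  rewrite big_ord_recl mulrDr; congr (_ + _).
    rewrite (big_pred1 set0) => [|S /=].
      rewrite cards0 subn0 /= expr0 mul1r mulr1 /detA.
      suff -> : \det (principal_minor A set0) = 1 by rewrite rmorph1 mulr1.
      move: (principal_minor A set0); rewrite cards0 => B; exact: det_mx00.
    apply/andP/eqP => [[S0 /eqP]|->]; last first.
      by rewrite inE cards0; split => //; apply/eqP/val_inj; rewrite /= inordK.
    by move/(congr1 val); rewrite /= inordK ?lt0 // => /cards0_eq.
  rewrite big_distrr /=; apply: eq_bigr => j _.
  rewrite mxE raddf_sum /= mulr_sumr !mulr_suml mulr_sumr.
  apply: eq_big => S.
    rewrite andbC; case S0: (ord0 \in S) => /=; rewrite ?andbF ?andbT //=.
    rewrite -val_eqE /= inordK //; apply: lt0; by rewrite S0.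
  case/andP=> S0 /eqP/(congr1 val); rewrite /= inordK ?lt0 //.
  rewrite -/(detA S); move: (detA S) => x ->.
  rewrite /bump /= add1n subSS -subnS.
  set y := s ^+ _; set z := t ^+ _; set e := (-1) ^+ _.
  by ring.
rewrite -mulNr big_distrr /=.
have gt0 (S : {set 'I_m.+1}) : ord0 \in S -> (0 < #|S|)%N.
  by move=> S0; apply/card_gt0P; exists ord0.
(* Here sizes run from 1 to [m + 1], hence the predecessor. *)
rewrite (partition_big (fun S : {set 'I_m.+1} => inord #|S|.-1) (fun _ : 'I_m.+1 => true)) //=.
apply: eq_bigr => j _.
rewrite piXE raddf_sum /= mulr_sumr !mulr_suml mulr_sumr.
have Kin (S : {set 'I_m.+1}) : ord0 \in S -> val (inord #|S|.-1 : 'I_m.+1) = #|S|.-1.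
  move=> S0; rewrite /= inordK //; by have := card_le S; have := gt0 _ S0; case: #|S|.
apply: eq_big => S.
  rewrite negbK andbC; case S0: (ord0 \in S) => /=; rewrite ?andbF ?andbT //=.
  rewrite -val_eqE Kin //; by have := gt0 _ S0; case: #|S|.
case/andP=> S0 /eqP/(congr1 val); rewrite negbK in S0; rewrite Kin // => Ej.
have Ec : #|S| = j.+1 by move: Ej; have := gt0 _ S0; case: #|S| => //= k _ ->.
rewrite !prod_split0 S0 in_setC S0 /= cardC -/(detA S); move: (detA S) => x.
rewrite Ec subSS /= exprS.
set y := s ^+ (m - _); set z := t ^+ _; set e := (-1) ^+ _.
by ring.
Qed.

(** * The polynomials P and Q, and the canonical form *)

Lemma block1_mxE (T : Type) (m : nat) (a : 'M[T]_1) (b : 'rV[T]_m) (c : 'cV[T]_m)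
    (d : 'M[T]_m) (B := block_mx a b c d : 'M[T]_m.+1) :
  (B ord0 ord0 = a ord0 ord0) *
  (forall j, B ord0 (lift ord0 j) = b ord0 j) *
  (forall i, B (lift ord0 i) ord0 = c i ord0) *
  (forall i j, B (lift ord0 i) (lift ord0 j) = d i j).
Proof.
have E (k : 'I_m) : lift ord0 k = rshift 1 k :> 'I_(1 + m) by apply: val_inj.
have E0 : ord0 = lshift m (ord0 : 'I_1) :> 'I_(1 + m) by apply: val_inj.
do !split=> *; rewrite /B.
- by rewrite -(block_mxEul a b c d) -E0.
- by rewrite -(block_mxEur a b c d) -E0 -E.
- by rewrite -(block_mxEdl a b c d) -E0 -E.
- by rewrite -(block_mxEdr a b c d) -!E.
Qed.

Section PencilPolynomials.

Variable m : nat.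
Implicit Types (A : 'M[C]_m.+1) (x : 'rV[C]_m.+1) (y : 'rV[C]_m).

(** The reversal of [Qpoly y]. For [y = piY A] it is the characteristic polynomial of [Ah], whereas
    [Qpoly y] is [det (1 - X Ah)]. *)
Definition charY y : {poly C} :=
  'X^m + \sum_(j < m) ((-1) ^+ j.+1 * y ord0 j)%:P * 'X^(m - j.+1).

Definition Qpoly y : {poly C} :=
  1 + \sum_(j < m) ((-1) ^+ j.+1 * y ord0 j)%:P * 'X^(j.+1).

Definition Ppoly x : {poly C} := \sum_(j < m.+1) ((-1) ^+ j * x ord0 j)%:P * 'X^j.

Lemma charYE y : 'X^m + \sum_(j < m) (-1) ^+ j.+1 * (y ord0 j)%:P * 1 ^+ j.+1 * 'X^(m - j.+1)
  = charY y.
Proof.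
congr (_ + _); apply: eq_bigr => j _.
by rewrite expr1n mulr1 polyCM rmorphXn rmorphN.
Qed.

Lemma PpolyE x : \sum_(j < m.+1) (-1) ^+ j * (x ord0 j)%:P * 'X^j * 1 ^+ (m - j) = Ppoly x.
Proof.
by apply: eq_bigr => j _; rewrite expr1n mulr1 polyCM rmorphXn rmorphN.
Qed.

Lemma coef_Ppoly x (j : 'I_m.+1) : (Ppoly x)`_j = (-1) ^+ j * x ord0 j.
Proof.
rewrite /Ppoly coef_sum (bigD1 j) //= big1 => [|i ij].
  by rewrite coefCM coefXn eqxx mulr1 addr0.
rewrite coefCM coefXn; case: eqP => [/val_inj E|_]; last by rewrite mulr0.
by rewrite E eqxx in ij.
Qed.

Lemma coef_charY y (i : 'I_m) : (charY y)`_i = (-1) ^+ (m - i) * y ord0 (rev_ord i).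
Proof.
rewrite /charY coefD coefXn ltn_eqF // add0r.
rewrite coef_sum (bigD1 (rev_ord i)) //= big1 => [|j ij].
  by rewrite coefCM coefXn !subnSK // subKn ?eqxx ?mulr1 ?addr0 // ltnW.
rewrite coefCM coefXn; case: eqP => [Ei|_]; last by rewrite mulr0.
by case/eqP: ij; apply/val_inj; rewrite /= Ei subnSK // subKn // ltnW.
Qed.

Lemma coef_Qpoly0 y : (Qpoly y)`_0 = 1.
Proof.
rewrite /Qpoly coefD coef1 eqxx coef_sum big1 ?addr0 // => i _.
by rewrite coefCM coefXn mulr0.
Qed.

Lemma coef_QpolyS y (i : 'I_m) : (Qpoly y)`_i.+1 = (-1) ^+ i.+1 * y ord0 i.
Proof.
rewrite /Qpoly coefD coef1 /= add0r coef_sum (bigD1 i) //= big1 => [|j ij].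
  by rewrite coefCM coefXn eqxx mulr1 addr0.
rewrite coefCM coefXn eqSS; case: eqP => [/val_inj E|_]; last by rewrite mulr0.
by rewrite E eqxx in ij.
Qed.

Lemma horner_Qpoly y z : (Qpoly y).[z] = Qn y z.
Proof.
rewrite /Qpoly /Qn !hornerE horner_sum; congr (_ + _); apply: eq_bigr => j _.
by rewrite hornerM hornerC hornerXn.
Qed.

Lemma horner_Ppoly x z : (Ppoly x).[z] = Pn x z.
Proof.
by rewrite /Ppoly /Pn horner_sum; apply: eq_bigr => j _; rewrite hornerM hornerC hornerXn.
Qed.

Lemma det_1_sub_mul A z w :
  \det (1%:M - A *m (\matrix_(i, j) (if i == j then (if (i : nat) == 0%N then w else z) else 0)))
  = Qn (piY A) z - w * Pn (piX A) z.
Proof.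
transitivity (\det (\matrix_(i, j) (split0 1 1 i *+ (i == j) - A i j * split0 w z j))).
  congr (\det _); apply/matrixP=> i j; rewrite !mxE /split0.
  congr (_ - _); first by case: (i == ord0); case: (i == j).
  rewrite (bigD1 j) //= big1 ?addr0 ?mxE ?eqxx => [//|k kj].
  by rewrite mxE (negbTE kj) mulr0.
rewrite (det_pencil idfun) /Qn /Pn mul1r expr1n; congr (_ + _ - _ * _);
  by apply: eq_bigr => j _; rewrite expr1n mulr1.
Qed.

Lemma det_col0 (R : comNzRingType) (B : 'M[R]_m.+1) :
  (forall i, B (lift ord0 i) ord0 = 0) ->
  \det B = B ord0 ord0 * \det (\matrix_(i, j) B (lift ord0 i) (lift ord0 j)).
Proof.
move=> B0; rewrite (expand_det_col _ ord0) big_ord_recl big1 ?addr0 => [|i _].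
  rewrite /cofactor addn0 mul1r; congr (_ * \det _).
  by apply/matrixP=> i j; rewrite !mxE.
by rewrite B0 mul0r.
Qed.

Lemma char_poly_hatmx A : char_poly (hatmx A) = charY (piY A).
Proof.
(* With [u = 1] and [v = 0] the first column of the pencil is the first basis vector, so that only
   the block [Ah] survives. *)
have := det_pencil polyC A 1 'X 0 1; rewrite mul0r subr0 mul1r.
rewrite det_col0 => [|i]; last by rewrite mxE mulr0 subr0.
rewrite !mxE /split0 /= mulr0 subr0 mulr1n mul1r.
have -> : \matrix_(i, j) (\matrix_(i, j) ((if i == ord0 then 1 else 'X) *+ (i == j)
       - (A i j)%:P * (if j == ord0 then 0 else 1))) (lift ord0 i) (lift ord0 j)
     = char_poly_mx (hatmx A).
  by apply/matrixP=> i j; rewrite !mxE /= mulr1 (inj_eq lift_inj).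
by rewrite /char_poly => ->; rewrite charYE.
Qed.

Definition revchar_mx A : 'M[{poly C}]_m := 1%:M - 'X *: map_mx polyC (hatmx A).

Lemma det_revchar_mx A : \det (revchar_mx A) = Qpoly (piY A).
Proof.
have := det_pencil polyC A 1 1 0 'X; rewrite mul0r subr0 mul1r expr1n.
rewrite det_col0 => [|i]; last by rewrite mxE mulr0 subr0.
rewrite !mxE /split0 /= mulr0 subr0 mulr1n mul1r.
have -> : \matrix_(i, j) (\matrix_(i, j) ((if i == ord0 then 1 else 1) *+ (i == j)
       - (A i j)%:P * (if j == ord0 then 0 else 'X))) (lift ord0 i) (lift ord0 j)
     = revchar_mx A.
  by apply/matrixP=> i j; rewrite !mxE /= (inj_eq lift_inj) mulrC.
move=> ->; congr (_ + _); apply: eq_bigr => j _.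
by rewrite expr1n mulr1 polyCM rmorphXn rmorphN.
Qed.

Definition firstrow_tail A : 'rV[C]_m := \row_j A ord0 (lift ord0 j).

(* Schur complement, with the adjugate in place of the inverse so as to stay in {poly C} *)
Lemma Ppoly_piX A :
  Ppoly (piX A) = (A ord0 ord0)%:P * Qpoly (piY A) +
    'X * (map_mx polyC (firstrow_tail A) *m \adj (revchar_mx A)
            *m map_mx polyC (firstcol_tail A)) ord0 ord0.
Proof.
set g := (_ *m _ *m _) ord0 ord0; set q := Qpoly _.
have q0 : q != 0.
  by apply/eqP=> /(congr1 (fun p : {poly C} => p`_0)) /eqP; rewrite coef_Qpoly0 coef0 oner_eq0.
(* The weights [u = 0] and [v = -1] isolate P. *)
have := det_pencil polyC A 0 1 (-1) 'X; rewrite mul0r add0r mulNr mul1r opprK.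
rewrite PpolyE.
pose b := map_mx polyC (firstrow_tail A); pose c := map_mx polyC (firstcol_tail A).
have -> : \matrix_(i, j) (split0 0 1 i *+ (i == j) - (A i j)%:P * split0 (-1) 'X j) =
   block_mx (A ord0 ord0)%:P%:M (- 'X *: b) c (revchar_mx A) :> 'M_(1 + m).
  apply/matrixP=> i j; rewrite mxE /split0.
  case: (unliftP ord0 i) => [i'|] ->; case: (unliftP ord0 j) => [j'|] ->;
    rewrite !block1_mxE !mxE /=.
  - by rewrite (inj_eq lift_inj) mulrC.
  - by rewrite mulr0n sub0r mulrN1 opprK.
  - by rewrite mulr0n sub0r mulrC mulNr.
  - by rewrite ?mulr1n sub0r mulrN1 opprK ?mulr1n.
set B := block_mx _ _ _ _ => detB; apply: (mulIf q0).
rewrite -{}detB.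
(* Right multiplication by this matrix of determinant [q] clears the first column below the corner,
   since [N \adj N = q]. The factor [q] is cancelled in the end: its constant term is 1. *)
pose B' := block_mx q%:M 0 (- \adj (revchar_mx A) *m c) 1%:M : 'M_(1 + m).
have {1}<- : \det B' = q by rewrite det_lblock det1 mulr1 det_scalar expr1.
transitivity (\det ((B : 'M_(1 + m)) *m B')); first by rewrite det_mulmx.
rewrite /B /B' mulmx_block !mulmx0 !mulmx1 !add0r.
rewrite !mulNmx !mulmxN !mulmxA mul_mx_adj det_revchar_mx -/q.
rewrite [c *m _]mul_mx_scalar [_ *m c in X in block_mx _ _ X]mul_scalar_mx subrr.
rewrite det_ublock det_revchar_mx -/q; congr (_ * _).
rewrite det_mx11 -scalar_mxM -!scalemxAl scaleNr opprK.
by rewrite mxE [_%:M _ _]mxE [fun_of_matrix (_ *: _) _ _]mxE eqxx mulr1n.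
Qed.

End PencilPolynomials.

(** * Normal form of a matrix whose first column is cyclic *)

Definition Krylov (k : nat) (X : 'M[C]_k) (v : 'cV[C]_k) : 'M[C]_k :=
  \matrix_(i < k, j < k) (X ^+ i *m v) j ord0.

Section CanonicalForm.

Variable m' : nat.
Let m := m'.+1.
Implicit Types (A : 'M[C]_m.+1) (x : 'rV[C]_m.+1) (y : 'rV[C]_m).

(** The orbit of [c] under [Ah] is the standard basis, that is, [c] is the first basis vector and
    [Ah] a companion matrix. *)
Definition canonical_pair A := Krylov (hatmx A) (firstcol_tail A) = 1%:M.

Lemma canonical_pairP A :
  canonical_pair A <->
  (forall k : 'I_m, hatmx A ^+ k *m firstcol_tail A = delta_mx k ord0).
Proof.
split=> [KA k|KA].
  apply/matrixP=> j l; rewrite ord1 [RHS]mxE eqxx andbT.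
  have := congr1 (fun B : 'M_m => B k j) KA; rewrite mxE [RHS]mxE => ->.
  by rewrite eq_sym.
by apply/matrixP=> i j; rewrite mxE KA !mxE eqxx andbT eq_sym.
Qed.

(** Indexed by [nat] so that it can be read at a difference [j - i]; the [inord] is faithful for
    [k <= m], the only range in use. *)
Definition Qcoef y (k : nat) : C :=
  if k is k'.+1 then (-1) ^+ k * y ord0 (inord k') else 1.

Lemma coef_Qpoly y k : (k <= m)%N -> (Qpoly y)`_k = Qcoef y k.
Proof.
case: k => [|k] lt_km; first exact: coef_Qpoly0.
by rewrite -[k in LHS](@inordK m') // coef_QpolyS /= inordK.
Qed.

(** Multiplication by Q modulo [X^(m+1)], acting on rows of coefficients. It is unitriangular
    because [Q(0) = 1]. *)
Definition toeplitz_mx y : 'M[C]_m.+1 :=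
  \matrix_(i, j) (if (i <= j)%N then Qcoef y (j - i) else 0).

(** The row of coefficients of [Ppoly x]. *)
Definition signed_row x : 'rV[C]_m.+1 := \row_j ((-1) ^+ j * x ord0 j).

Lemma signed_row_inj : injective signed_row.
Proof.
move=> x x' /matrixP E; apply/rowP => j; have := E ord0 j; rewrite !mxE.
by apply: mulfI; rewrite signr_eq0.
Qed.

Lemma det_toeplitz_mx y : \det (toeplitz_mx y) = 1.
Proof.
rewrite -det_tr det_trig; last first.
  by apply/is_trig_mxP => i j ij; rewrite !mxE leqNgt ij.
by rewrite big1 // => i _; rewrite !mxE leqnn subnn.
Qed.

(* For a canonical pair the Markov parameters b * Ah^k * c are the entries of b, so that
   P / Q has the entries of the first row of A as its first Taylor coefficients at 0. *)
Lemma canonical_row0 A : canonical_pair A ->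
  signed_row (piX A) = row ord0 A *m toeplitz_mx (piY A).
Proof.
move/canonical_pairP=> KA.
pose N := revchar_mx A; pose b := map_mx polyC (firstrow_tail A).
pose c := map_mx polyC (firstcol_tail A); pose Ah := map_mx polyC (hatmx A).
pose h := \sum_(k < m) (firstrow_tail A ord0 k)%:P * 'X^k.
have [g' Eg] : exists g', (b *m \adj N *m c) ord0 ord0 = Qpoly (piY A) * h + 'X^m * g'.
  exists ((b *m \adj N *m (Ah ^+ m *m c)) ord0 ord0).
  (* The Neumann series of [(1 - X Ah)^-1 c], cut off after [m] terms, telescopes; the error has
     order [X^m] and does not reach the coefficients compared below. *)
  have tele : N *m (\sum_(k < m) 'X^k *: (Ah ^+ k *m c)) = c - 'X^m *: (Ah ^+ m *m c).
    rewrite mulmx_sumr.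
    have -> : c - 'X^m *: (Ah ^+ m *m c) =
        - ('X^m *: (Ah ^+ m *m c) - 'X^0 *: (Ah ^+ 0 *m c)).
      by rewrite opprB expr0 scale1r mul1mx.
    rewrite -(telescope_sumr (fun k => 'X^k *: (Ah ^+ k *m c))) // big_mkord -sumrN.
    apply: eq_bigr => k _; rewrite opprB /N /revchar_mx mulmxBl mul1mx; congr (_ - _).
    rewrite -/Ah -scalemxAl -scalemxAr scalerA -exprS; congr (_ *: _).
    by rewrite mulmxA exprS.
  have hE : h = (b *m \sum_(k < m) 'X^k *: (Ah ^+ k *m c)) ord0 ord0.
    rewrite mulmx_sumr summxE; apply: eq_bigr => k _.
    rewrite -scalemxAr [RHS]mxE mulrC; congr (_ * _).
    have -> : Ah ^+ k *m c = map_mx polyC (hatmx A ^+ k *m firstcol_tail A).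
      by rewrite map_mxM rmorphXn.
    rewrite KA -map_mxM [RHS]mxE; congr (_%:P).
    rewrite [RHS]mxE (bigD1 k) //= big1 => [|l lk].
      by rewrite [delta_mx _ _ _ _]mxE !eqxx mulr1 addr0.
    by rewrite [delta_mx _ _ _ _]mxE (negbTE lk) mulr0.
  have Ec : c = N *m (\sum_(k < m) 'X^k *: (Ah ^+ k *m c)) + 'X^m *: (Ah ^+ m *m c).
    by rewrite tele subrK.
  rewrite [X in (_ *m X) _ _ = _]Ec mulmxDr mxE; congr (_ + _); last by rewrite -scalemxAr mxE.
  rewrite mulmxA -[_ *m \adj N *m N]mulmxA mul_adj_mx det_revchar_mx mul_mx_scalar.
  by rewrite -scalemxAl mxE hE.
have EP := Ppoly_piX A; rewrite -/b -/N -/c Eg in EP.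
pose beta := \sum_(k < m.+1) (A ord0 k)%:P * 'X^k.
have {EP} EP : Ppoly (piX A) = beta * Qpoly (piY A) + 'X^(m.+1) * g'.
  have -> : beta = (A ord0 ord0)%:P + 'X * h.
    rewrite /beta big_ord_recl expr0 mulr1 /h big_distrr; congr (_ + _).
    by apply: eq_bigr => k _ /=; rewrite mxE mulrCA -exprS.
  by rewrite EP exprS; ring.
apply/rowP=> j; rewrite mxE -coef_Ppoly EP coefD coefXnM ltn_ord addr0 coefM mxE.
have cb (i : 'I_m.+1) : beta`_i = A ord0 i.
  rewrite /beta coef_sum (bigD1 i) //= big1 => [|l li].
    by rewrite coefCM coefXn eqxx mulr1 addr0.
  rewrite coefCM coefXn; case: eqP => [/val_inj E|_]; last by rewrite mulr0.
  by rewrite E eqxx in li.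
rewrite [RHS](bigID (fun i : 'I_m.+1 => (i <= j)%N)) /= [X in _ + X]big1 ?addr0; last first.
  by move=> i /negbTE ij; rewrite !mxE ij mulr0.
rewrite (big_ord_widen_cond m.+1 (fun=> true) (fun i => beta`_i * (Qpoly (piY A))`_(j - i))) //=.
apply: eq_big => [i|i ij]; first by rewrite ltnS.
rewrite !mxE cb -ltnS ij coef_Qpoly //.
by apply: leq_trans (leq_subr _ _) _; rewrite -ltnS.
Qed.

(** The adjugate is the inverse, as the determinant is 1, and it keeps the dependence on [y]
    polynomial. *)
Lemma canonical_row0_adj A : canonical_pair A ->
  row ord0 A = signed_row (piX A) *m \adj (toeplitz_mx (piY A)).
Proof.
by move/canonical_row0 ->; rewrite -mulmxA mul_mx_adj det_toeplitz_mx mulmx1.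
Qed.

Lemma canonical_col A (j : 'I_m) : canonical_pair A ->
  col j (hatmx A) = hatmx A ^+ j.+1 *m firstcol_tail A.
Proof.
move/canonical_pairP=> KA; rewrite exprS -[_ * _]/(_ *m _) -mulmxA KA.
by rewrite colE.
Qed.

(** The last column is [Ah^m c]. Cayley-Hamilton expands it in the basis [Ah^k c = e_k], with the
    coefficients of the characteristic polynomial. *)
Lemma canonical_lastcol A (i : 'I_m) : canonical_pair A ->
  hatmx A i ord_max = - ((-1) ^+ (m - i) * piY A ord0 (rev_ord i)).
Proof.
move=> KA; have := canonical_col ord_max KA => /(congr1 (fun B : 'cV_m => B i ord0)).
rewrite mxE => ->; rewrite -coef_charY -char_poly_hatmx.
have := Cayley_Hamilton (hatmx A); set p := char_poly _.
have sp : size p = m.+1 by rewrite /p size_char_poly.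
have mon : p`_m = 1.
  by have /monicP := char_poly_monic (hatmx A); rewrite lead_coefE size_char_poly.
rewrite -[p in horner_mx _ p]coefK sp poly_def rmorph_sum /= big_ord_recr /= mon.
rewrite scale1r rmorphXn /= horner_mx_X => /eqP; rewrite addrC addr_eq0 => /eqP ->.
rewrite mulNmx mxE mulmx_suml summxE; congr (- _).
rewrite (bigD1 i) //= big1 => [|k ki].
  rewrite linearZ /= rmorphXn /= horner_mx_X -scalemxAl mxE.
  by rewrite (canonical_pairP A).1 // mxE !eqxx mulr1 addr0.
rewrite linearZ /= rmorphXn /= horner_mx_X -scalemxAl mxE.
by rewrite (canonical_pairP A).1 // mxE eq_sym (negbTE ki) mulr0.
Qed.

(** Below the first row, column [j < m] is [e_j]: column 0 is [c = e_0], and column [j] of the whole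
    matrix is column [j - 1] of [Ah], namely [Ah e_(j-1)]. *)
Definition canonical_mx (xy : 'rV[C]_m.+1 * 'rV[C]_m) : 'M[C]_m.+1 :=
  \matrix_(i, j)
    if unlift ord0 i is Some i' then
      if j == ord_max then - ((-1) ^+ (m - i') * xy.2 ord0 (rev_ord i'))
      else ((i' : nat) == j)%:R
    else (signed_row xy.1 *m \adj (toeplitz_mx xy.2)) ord0 j.

Lemma canonical_mx_pi A : canonical_pair A -> A = canonical_mx (pi_n A).
Proof.
move=> KA; apply/matrixP=> i j; rewrite mxE.
case: (unliftP ord0 i) => [i'|] ->; last by rewrite -canonical_row0_adj // mxE.
case: eqP => [->|/eqP jmax].
  have -> : ord_max = lift ord0 (ord_max : 'I_m) by apply: val_inj.
  by rewrite -canonical_lastcol // mxE.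
have lt_jm : (j < m)%N.
  by rewrite ltn_neqAle -ltnS ltn_ord andbT; apply: contra jmax => /eqP E; apply/eqP/val_inj.
case: (unliftP ord0 j) lt_jm => [j'|] -> lt_jm.
  have lt_j'm : (j'.+1 < m)%N by [].
  have := canonical_col j' KA => /(congr1 (fun B : 'cV_m => B i' ord0)).
  rewrite mxE [hatmx _ _ _]mxE => ->.
  by rewrite ((canonical_pairP A).1 KA (Ordinal lt_j'm)) mxE eqxx andbT -val_eqE.
have := (canonical_pairP A).1 KA (Ordinal lt_jm) => /(congr1 (fun B : 'cV_m => B i' ord0)).
by rewrite /= expr0 mul1mx !mxE eqxx andbT -val_eqE.
Qed.

Lemma canonical_mx_canonical xy : canonical_pair (canonical_mx xy).
Proof.
apply/canonical_pairP => -[k]; elim: k => [|k IHk] lt_km /=.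
  rewrite expr0 mul1mx; apply/colP=> i; rewrite !mxE liftK eqxx andbT -val_eqE.
  by [].
have lt_km' : (k < m)%N by apply: ltnW.
rewrite exprS -[_ * _]/(_ *m _) -mulmxA (IHk lt_km') -colE.
apply/colP=> i; rewrite !mxE liftK eqxx andbT -!val_eqE /=.
rewrite /bump /= add1n eqSS; case: eqP => // E.
by move: lt_km; rewrite E ltnn.
Qed.

(** No minor is computed. Being canonical, the matrix is also the canonical matrix of its own image
    under [pi_n], and [canonical_mx] is injective: the last column determines [y], and then the
    first row determines [x]. *)
Lemma pi_canonical_mx xy : pi_n (canonical_mx xy) = xy.
Proof.
have KA := canonical_mx_canonical xy; have EA := canonical_mx_pi KA.
set xy' := pi_n _ in EA *; case: xy xy' EA {KA} => x y [x' y'] /= EA.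
have Ey : y' = y.
  apply/rowP=> j.
  have := congr1 (fun B : 'M_m.+1 => B (lift ord0 (rev_ord j)) ord_max) EA.
  rewrite !mxE liftK eqxx /= !rev_ordK => /oppr_inj/mulfI E; symmetry; apply: E.
  by rewrite signr_eq0.
rewrite Ey in EA *; congr (_, _); apply: signed_row_inj.
have E : signed_row x *m \adj (toeplitz_mx y) = signed_row x' *m \adj (toeplitz_mx y).
  apply/rowP=> j; have := congr1 (fun B : 'M_m.+1 => B ord0 j) EA.
  by rewrite !mxE unlift_none.
have := congr1 (fun v : 'rV_m.+1 => v *m toeplitz_mx y) E.
by rewrite -!mulmxA mul_adj_mx det_toeplitz_mx !mulmx1.
Qed.

End CanonicalForm.

(** * Invariance of [pi_n] under conjugation by [1 (+) K] *)

Section Conjugation.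

Variable m : nat.
Implicit Types (A : 'M[C]_m.+1) (K : 'M[C]_m).

(** The inverse is a separate argument [K'], because the lifting supplies both factors as entire
    functions. *)
Definition conj1 K K' A : 'M[C]_m.+1 :=
  (block_mx 1%:M 0 0 K : 'M[C]_(1 + m)) *m (A : 'M[C]_(1 + m)) *m
  (block_mx 1%:M 0 0 K' : 'M[C]_(1 + m)).

Lemma block1_mx A :
  A = block_mx (A ord0 ord0)%:M (firstrow_tail A) (firstcol_tail A) (hatmx A).
Proof.
apply/matrixP=> i j.
by case: (unliftP ord0 i) => [i'|] ->; case: (unliftP ord0 j) => [j'|] ->;
  rewrite !block1_mxE !mxE.
Qed.

Lemma conj1E K K' A :
  conj1 K K' A = block_mx (A ord0 ord0)%:M (firstrow_tail A *m K')
                   (K *m firstcol_tail A) (K *m hatmx A *m K').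
Proof.
rewrite /conj1 [in LHS](block1_mx A) !mulmx_block.
by rewrite !mul0mx !mulmx0 !mulmx1 !mul1mx !addr0 !add0r.
Qed.

Lemma hatmx_conj1 K K' A : hatmx (conj1 K K' A) = K *m hatmx A *m K'.
Proof. by rewrite conj1E; apply/matrixP=> i j; rewrite mxE block1_mxE. Qed.

Lemma firstcol_tail_conj1 K K' A : firstcol_tail (conj1 K K' A) = K *m firstcol_tail A.
Proof. by rewrite conj1E; apply/colP=> i; rewrite mxE block1_mxE. Qed.

Lemma conj1K K K' A : K *m K' = 1%:M -> conj1 K K' (conj1 K' K A) = A.
Proof.
move=> KK'; rewrite /conj1 !mulmxA mulmx_block -!mulmxA mulmx_block.
rewrite !mul0mx !mulmx0 !mulmx1 !addr0 !add0r KK'.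
by rewrite -!scalar_mx_block mul1mx mulmx1.
Qed.

(** [1 (+) K] commutes with [u (+) s I] and [v (+) t I], so the whole pencil is conjugated. *)
Lemma det_pencil_conj1 (R : comNzRingType) (phi : {rmorphism C -> R}) K K' A (u s v t : R) :
  K *m K' = 1%:M ->
  \det (\matrix_(i, j) (split0 u s i *+ (i == j) - phi (conj1 K K' A i j) * split0 v t j)) =
  \det (\matrix_(i, j) (split0 u s i *+ (i == j) - phi (A i j) * split0 v t j)).
Proof.
move=> KK'.
have pencilE (B : 'M[C]_m.+1) :
    \matrix_(i, j) (split0 u s i *+ (i == j) - phi (B i j) * split0 v t j) =
    block_mx (u - phi (B ord0 ord0) * v)%:M (- t *: map_mx phi (firstrow_tail B))
      (- v *: map_mx phi (firstcol_tail B)) (s%:M - t *: map_mx phi (hatmx B)) :> 'M_m.+1.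
  apply/matrixP=> i j.
  case: (unliftP ord0 i) => [i'|] ->; case: (unliftP ord0 j) => [j'|] ->;
    rewrite !block1_mxE !mxE /split0 /=.
  - by rewrite (inj_eq lift_inj) mulrC.
  - by rewrite mulr0n sub0r mulrC mulNr.
  - by rewrite mulr0n sub0r mulrC mulNr.
  - by rewrite mulr1n.
have fKK' : map_mx phi K *m map_mx phi K' = 1%:M by rewrite -map_mxM KK' map_mx1.
transitivity (\det ((block_mx 1%:M 0 0 (map_mx phi K) : 'M_(1 + m)) *m
  (\matrix_(i, j) (split0 u s i *+ (i == j) - phi (A i j) * split0 v t j) : 'M_(1 + m)) *m
  (block_mx 1%:M 0 0 (map_mx phi K') : 'M_(1 + m)))); last first.
  rewrite !det_mulmx mulrAC -det_mulmx mulmx_block.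
  rewrite !mul0mx !mulmx0 !mulmx1 !addr0 !add0r fKK'.
  by rewrite -scalar_mx_block det1 mul1r.
congr (\det _); rewrite !pencilE !mulmx_block.
rewrite !mul0mx !mulmx0 !mulmx1 !mul1mx !addr0 !add0r.
have -> : firstrow_tail (conj1 K K' A) = firstrow_tail A *m K'.
  by rewrite conj1E; apply/rowP=> j; rewrite mxE block1_mxE.
rewrite firstcol_tail_conj1 hatmx_conj1 !map_mxM /=.
have -> : conj1 K K' A ord0 ord0 = A ord0 ord0.
  by rewrite conj1E block1_mxE mxE.
rewrite mulmxBr mulmxBl mul_mx_scalar -[s *: _ *m _]scalemxAl fKK' scalemx1.
by rewrite -!scalemxAr -!scalemxAl -!mulmxA.
Qed.

Lemma pi_n_conj1 K K' A : K *m K' = 1%:M -> pi_n (conj1 K K' A) = pi_n A.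
Proof.
move=> KK'; congr (_, _); apply/rowP=> j.
  have := det_pencil_conj1 polyC A 0 1 (-1) 'X KK'; rewrite !det_pencil.
  rewrite !mul0r !add0r !mulNr !mul1r !opprK => E.
  rewrite !PpolyE in E.
  have := congr1 (fun p : {poly C} => p`_j) E; rewrite !coef_Ppoly.
  by apply: mulfI; rewrite signr_eq0.
have E : charY (piY (conj1 K K' A)) = charY (piY A).
  have := det_pencil_conj1 polyC A 1 'X 0 1 KK'; rewrite !det_pencil.
  by rewrite !mul0r !subr0 !mul1r !charYE.
rewrite -[j]rev_ordK; have := congr1 (fun p : {poly C} => p`_(rev_ord j)) E.
by rewrite !coef_charY; apply: mulfI; rewrite signr_eq0.
Qed.

End Conjugation.

Lemma cyclic_canonical (m' : nat) (A : 'M[C]_m'.+2) :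
  cyclic_vector (hatmx A) (firstcol_tail A) ->
  exists K K' : 'M[C]_m'.+1, K' *m K = 1%:M /\ A = conj1 K K' (canonical_mx (pi_n A)).
Proof.
(* [Krylov] stores the vectors [Ah^k c] as rows, as [cyclic_vector] does; the transpose sends [e_k]
   to [Ah^k c]. *)
move=> cyc; pose K := (Krylov (hatmx A) (firstcol_tail A))^T.
have Ku : K \in unitmx by rewrite unitmx_tr -row_full_unit.
exists K, (invmx K); rewrite mulVmx //; split=> //.
have KV : K *m invmx K = 1%:M by rewrite mulmxV.
have VK : invmx K *m K = 1%:M by rewrite mulVmx.
rewrite -(pi_n_conj1 A VK) -canonical_mx_pi ?conj1K //.
apply/canonical_pairP => k; rewrite hatmx_conj1 firstcol_tail_conj1.
have -> : (invmx K *m hatmx A *m K) ^+ k = invmx K *m hatmx A ^+ k *m K.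
  elim: (k : nat) => [|l IHl]; first by rewrite !expr0 mulmx1 VK.
  by rewrite !exprS IHl -!mulmxE !mulmxA -[_ *m K *m invmx K]mulmxA KV mulmx1.
rewrite -[LHS]mulmxA (mulmxA K) KV mul1mx -mulmxA.
have -> : hatmx A ^+ k *m firstcol_tail A = K *m delta_mx k ord0.
  by rewrite -colE; apply/colP=> i; rewrite [RHS]mxE [RHS]mxE [RHS]mxE.
by rewrite mulmxA VK mul1mx.
Qed.

(** * Complex analysis *)

(* mathcomp has taken over the key %R for ring_scope *)
Delimit Scope R_scope with Re.
Arguments Cabs z%R.
Arguments Cabs2 z%R.
Arguments re c%R.
Arguments im c%R.

Lemma reD (a b : C) : re (a + b) = (re a + re b)%Re. Proof. by []. Qed.
Lemma imD (a b : C) : im (a + b) = (im a + im b)%Re. Proof. by []. Qed.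
Lemma reN (a : C) : re (- a) = (- re a)%Re. Proof. by []. Qed.
Lemma imN (a : C) : im (- a) = (- im a)%Re. Proof. by []. Qed.
Lemma reM (a b : C) : re (a * b) = (re a * re b - im a * im b)%Re. Proof. by []. Qed.
Lemma imM (a b : C) : im (a * b) = (re a * im b + im a * re b)%Re. Proof. by []. Qed.

Lemma Cabs2_ge0 a : (0 <= Cabs2 a)%Re.
Proof. rewrite /Cabs2; nra. Qed.

Lemma Cabs_ge0 a : (0 <= Cabs a)%Re.
Proof. exact: sqrt_pos. Qed.

Lemma Cabs_sqr a : (Cabs a * Cabs a = Cabs2 a)%Re.
Proof. exact: sqrt_sqrt (Cabs2_ge0 a). Qed.

Lemma Cabs0 : Cabs 0 = 0%Re.
Proof. by rewrite /Cabs /Cabs2 /= Rmult_0_l Rplus_0_l sqrt_0. Qed.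

Lemma Cabs_eq0 a : Cabs a = 0%Re -> a = 0.
Proof.
move=> a0; have := Cabs_sqr a; rewrite a0 /Cabs2 => E.
by apply: C_ext => /=; nra.
Qed.

Lemma CabsN a : Cabs (- a) = Cabs a.
Proof. by rewrite /Cabs /Cabs2 reN imN; congr sqrt; lra. Qed.

Lemma CabsM a b : Cabs (a * b) = (Cabs a * Cabs b)%Re.
Proof.
rewrite /Cabs -sqrt_mult; try exact: Cabs2_ge0.
by congr sqrt; rewrite /Cabs2 reM imM; real_ring.
Qed.

Lemma sqr_le_le (x y : R) : (0 <= y -> x * x <= y * y -> x <= y)%Re.
Proof. move=> *; nra. Qed.

Lemma CabsD a b : (Cabs (a + b) <= Cabs a + Cabs b)%Re.
Proof.
have := Cabs_ge0 a; have := Cabs_ge0 b => b0 a0.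
apply: sqr_le_le; first lra.
have CS : (re a * re b + im a * im b <= Cabs a * Cabs b)%Re.
  apply: sqr_le_le; first nra.
  have -> : (Cabs a * Cabs b * (Cabs a * Cabs b) = (Cabs a * Cabs a) * (Cabs b * Cabs b))%Re.
    by real_ring.
  rewrite !Cabs_sqr /Cabs2; have := Rle_0_sqr (re a * im b - im a * re b); rewrite /Rsqr; nra.
have := Cabs_sqr a; have := Cabs_sqr b; have := Cabs_sqr (a + b).
rewrite /Cabs2 reD imD; nra.
Qed.

Lemma CabsB a b : (Cabs (a - b) <= Cabs a + Cabs b)%Re.
Proof. by rewrite -(CabsN b); apply: CabsD. Qed.

Lemma Cabs_re a : (Rabs (re a) <= Cabs a)%Re.
Proof.
apply: sqr_le_le; first exact: Cabs_ge0.
by rewrite Cabs_sqr /Cabs2 -Rabs_mult Rabs_pos_eq; nra.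
Qed.

Lemma Cabs_im a : (Rabs (im a) <= Cabs a)%Re.
Proof.
apply: sqr_le_le; first exact: Cabs_ge0.
by rewrite Cabs_sqr /Cabs2 -Rabs_mult Rabs_pos_eq; nra.
Qed.

Lemma Cabs_le_re_im a : (Cabs a <= Rabs (re a) + Rabs (im a))%Re.
Proof.
have := Rabs_pos (re a); have := Rabs_pos (im a) => ? ?.
apply: sqr_le_le; first lra.
rewrite Cabs_sqr /Cabs2.
have := Rabs_mult (re a) (re a); have := Rabs_mult (im a) (im a).
rewrite !(Rabs_pos_eq (_ * _)); nra.
Qed.

(** * Classes of functions closed under polynomial operations *)

Section FunctionAlgebras.

Variables (T : Type) (D : (T -> C) -> Prop).

(** Determinants, adjugates, [pi_n] and [canonical_mx] preserve every such class. The instances are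
    differentiability at a point (in one variable or in matrix entries), entire functions, and
    locally Lipschitz functions. *)
Definition function_algebra :=
  [/\ forall c, D (fun=> c),
      forall f g, D f -> D g -> D (fun t => f t + g t) &
      forall f g, D f -> D g -> D (fun t => f t * g t)].

Hypothesis algD : function_algebra.

Lemma alg_cst c : D (fun=> c). Proof. by case: algD. Qed.
Lemma alg_add f g : D f -> D g -> D (fun t => f t + g t).
Proof. by case: algD => _ H _; apply: H. Qed.
Lemma alg_mul f g : D f -> D g -> D (fun t => f t * g t).
Proof. by case: algD => _ _; apply. Qed.

Lemma alg_eq f g : f =1 g -> D f -> D g.
Proof. by move=> /functional_extensionality ->. Qed.

Lemma alg_opp f : D f -> D (fun t => - f t).
Proof.
move=> Df; apply: (@alg_eq (fun t => (-1) * f t)); first by move=> t; rewrite mulN1r.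
exact: alg_mul (alg_cst _) Df.
Qed.

Lemma alg_sum (I : Type) (r : seq I) (P : pred I) (F : I -> T -> C) :
  (forall i, P i -> D (F i)) -> D (fun t => \sum_(i <- r | P i) F i t).
Proof.
move=> DF; elim: r => [|i r IHr].
  by apply: (@alg_eq (fun=> 0)) => [t|]; rewrite ?big_nil //; apply: alg_cst.
case Pi: (P i); last by apply: alg_eq IHr => t; rewrite big_cons Pi.
by apply: alg_eq (alg_add (DF _ Pi) IHr) => t; rewrite big_cons Pi.
Qed.

Lemma alg_prod (I : Type) (r : seq I) (P : pred I) (F : I -> T -> C) :
  (forall i, P i -> D (F i)) -> D (fun t => \prod_(i <- r | P i) F i t).
Proof.
move=> DF; elim: r => [|i r IHr].
  by apply: (@alg_eq (fun=> 1)) => [t|]; rewrite ?big_nil //; apply: alg_cst.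
case Pi: (P i); last by apply: alg_eq IHr => t; rewrite big_cons Pi.
by apply: alg_eq (alg_mul (DF _ Pi) IHr) => t; rewrite big_cons Pi.
Qed.

Definition alg_mx (p q : nat) (F : T -> 'M[C]_(p, q)) := forall i j, D (fun t => F t i j).

Lemma alg_mx_cst p q (B : 'M[C]_(p, q)) : alg_mx (fun=> B).
Proof. move=> i j; exact: alg_cst. Qed.

Lemma alg_mulmx p q r (F : T -> 'M[C]_(p, q)) (G : T -> 'M[C]_(q, r)) :
  alg_mx F -> alg_mx G -> alg_mx (fun t => F t *m G t).
Proof.
move=> DF DG i j; apply: (@alg_eq (fun t => \sum_k F t i k * G t k j)).
  by move=> t; rewrite mxE.
by apply: alg_sum => k _; apply: alg_mul.
Qed.

Lemma alg_block_mx p1 p2 q1 q2 (Ful : T -> 'M[C]_(p1, q1)) (Fur : T -> 'M[C]_(p1, q2))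
    (Fdl : T -> 'M[C]_(p2, q1)) (Fdr : T -> 'M[C]_(p2, q2)) :
  alg_mx Ful -> alg_mx Fur -> alg_mx Fdl -> alg_mx Fdr ->
  alg_mx (fun t => block_mx (Ful t) (Fur t) (Fdl t) (Fdr t)).
Proof.
move=> D1 D2 D3 D4 i j.
case: (split_ordP i) => k ->; case: (split_ordP j) => l ->.
- by apply: alg_eq (D1 k l) => t; rewrite block_mxEul.
- by apply: alg_eq (D2 k l) => t; rewrite block_mxEur.
- by apply: alg_eq (D3 k l) => t; rewrite block_mxEdl.
- by apply: alg_eq (D4 k l) => t; rewrite block_mxEdr.
Qed.

Lemma alg_det p (F : T -> 'M[C]_p) : alg_mx F -> D (fun t => \det (F t)).
Proof.
move=> DF; rewrite /determinant; apply: alg_sum => s _; apply: alg_mul.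
  exact: alg_cst.
by apply: alg_prod => i _; apply: DF.
Qed.

Lemma alg_adj p (F : T -> 'M[C]_p) : alg_mx F -> alg_mx (fun t => \adj (F t)).
Proof.
move=> DF i j; apply: (@alg_eq (fun t => cofactor (F t) j i)); first by move=> t; rewrite mxE.
rewrite /cofactor; apply: alg_mul; first exact: alg_cst.
by apply: alg_det => k l; apply: alg_eq (DF (lift j k) (lift i l)) => t; rewrite !mxE.
Qed.

Lemma alg_horner (p : {poly C}) f : D f -> D (fun t => p.[f t]).
Proof.
move=> Df; apply: (@alg_eq (fun t => \sum_(i < size p) p`_i * f t ^+ i)).
  by move=> t; rewrite horner_coef.
apply: alg_sum => i _; apply: alg_mul; first exact: alg_cst.
elim: (i : nat) => [|k IHk]; first exact: alg_cst.
by apply: alg_eq (alg_mul Df IHk) => t; rewrite exprS.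
Qed.

Lemma alg_pi_n (m : nat) (F : T -> 'M[C]_m.+1) : alg_mx F ->
  alg_mx (fun t => (pi_n (F t)).1) /\ alg_mx (fun t => (pi_n (F t)).2).
Proof.
move=> DF.
have Dminor (S : {set 'I_m.+1}) : D (fun t => \det (principal_minor (F t) S)).
  by apply: alg_det => i j; apply: alg_eq (DF (enum_val i) (enum_val j)) => t; rewrite mxE.
split=> i j; rewrite ord1 /=.
  by apply: alg_eq (alg_sum _ (fun S _ => Dminor S)) => t; rewrite piXE.
by apply: alg_eq (alg_sum _ (fun S _ => Dminor S)) => t; rewrite mxE.
Qed.

Lemma alg_canonical_mx (m' : nat) (f : T -> 'rV[C]_m'.+2 * 'rV[C]_m'.+1) :
  alg_mx (fun t => (f t).1) -> alg_mx (fun t => (f t).2) ->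
  alg_mx (fun t => canonical_mx (f t)).
Proof.
move=> Dx Dy i j; rewrite /canonical_mx.
apply: (@alg_eq (fun t => if unlift ord0 i is Some i' then
      if j == ord_max then - ((-1) ^+ (m'.+1 - i') * (f t).2 ord0 (rev_ord i'))
      else ((i' : nat) == j)%:R
    else (signed_row (f t).1 *m \adj (toeplitz_mx (f t).2)) ord0 j)).
  by move=> t; rewrite [RHS]mxE.
case: (unlift ord0 i) => [i'|].
  case: (j == ord_max); last exact: alg_cst.
  by apply/alg_opp/alg_mul; [exact: alg_cst | exact: Dy].
apply: (alg_mulmx (F := fun t => signed_row (f t).1)
                 (G := fun t => \adj (toeplitz_mx (f t).2))).
  move=> k l; apply: alg_eq (alg_mul (alg_cst ((-1) ^+ l)) (Dx ord0 l)) => t.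
  by rewrite [RHS]mxE.
apply: alg_adj => k l.
apply: (@alg_eq (fun t => if (k <= l)%N then Qcoef (f t).2 (l - k) else 0)).
  by move=> t; rewrite mxE.
case: leqP => _; last exact: alg_cst.
case: (l - k)%N => [|d]; first exact: alg_cst.
by apply: alg_mul; [exact: alg_cst | exact: Dy].
Qed.

End FunctionAlgebras.

Lemma function_algebra_iff (T : Type) (D D' : (T -> C) -> Prop) :
  (forall f, D f <-> D' f) -> function_algebra D -> function_algebra D'.
Proof.
move=> DD' [Dc Da Dm]; split=> [c|f g|f g]; rewrite -!DD' //; [exact: Da | exact: Dm].
Qed.

(* One notion covers [Cdiff_at] and [Cdiff_mx_at]: [Lin] is the class of admissible
   differentials and [N] the norm of the increments. *)
Section Differentiability.

Variables (T : zmodType) (N : T -> R) (Lin : (T -> C) -> Prop).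
Hypothesis N_ge0 : forall h, (0 <= N h)%Re.
Hypothesis Lin_bounded : forall L, Lin L ->
  exists B, (0 <= B)%Re /\ forall h, (Cabs (L h) <= B * N h)%Re.
Hypothesis Lin0 : Lin (fun=> 0).
Hypothesis LinD : forall L L', Lin L -> Lin L' -> Lin (fun h => L h + L' h).
Hypothesis LinZ : forall c L, Lin L -> Lin (fun h => c * L h).

Definition diff_at (p : T) (g : T -> C) :=
  exists2 L, Lin L & forall eps, (0 < eps)%Re -> exists delta, (0 < delta)%Re /\
    forall h, (N h < delta)%Re -> (Cabs (g (p + h)%R - g p - L h) <= eps * N h)%Re.

Lemma diff_at_algebra p : function_algebra (diff_at p).
Proof.
split.
- move=> c; exists (fun=> 0) => // eps eps0; exists 1%Re; split=> [|h _]; first lra.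
  rewrite subrr subr0 Cabs0; have := N_ge0 h; nra.
- move=> f g [L LL dL] [L' LL' dL']; exists (fun h => L h + L' h); first exact: LinD.
  move=> eps eps0; have [d1 [d10 H1]] := dL (eps / 2)%Re ltac:(lra).
  have [d2 [d20 H2]] := dL' (eps / 2)%Re ltac:(lra).
  exists (Rmin d1 d2); split=> [|h Hh]; first exact: Rmin_glb_lt.
  have {}H1 := H1 h (Rlt_le_trans _ _ _ Hh (Rmin_l _ _)).
  have {}H2 := H2 h (Rlt_le_trans _ _ _ Hh (Rmin_r _ _)).
  have -> : f (p + h) + g (p + h) - (f p + g p) - (L h + L' h) =
    (f (p + h) - f p - L h) + (g (p + h) - g p - L' h) by ring.
  apply: Rle_trans (CabsD _ _) _; lra.
- move=> f g [L LL dL] [L' LL' dL'].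
  exists (fun h => f p * L' h + g p * L h); first by apply: LinD; apply: LinZ.
  have [B [B0 HB]] := Lin_bounded LL; have [B' [B'0 HB']] := Lin_bounded LL'.
  move=> eps eps0.
  have [f0 g0] := (Cabs_ge0 (f p), Cabs_ge0 (g p)).
  (* [G] dominates the factors [f (p + h)] and [g p] that multiply the two remainders. The radius
     [d3] takes care of the second-order term, at most [(B + 1) (B' + 1) (N h)^2]. *)
  pose G := (Cabs (f p) + B + 1 + Cabs (g p) + 1)%Re.
  have G0 : (0 < G)%Re by rewrite /G; lra.
  pose e1 := (eps / (3 * G))%Re.
  have e10 : (0 < e1)%Re by apply: Rdiv_lt_0_compat; lra.
  have e1G : (e1 * G = eps / 3)%Re by rewrite /e1; real_field; lra.
  pose d3 := (eps / (3 * ((B + 1) * (B' + 1))))%Re.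
  have BB' : (0 < (B + 1) * (B' + 1))%Re by nra.
  have d30 : (0 < d3)%Re by apply: Rdiv_lt_0_compat; lra.
  have d3B : (d3 * ((B + 1) * (B' + 1)) = eps / 3)%Re by rewrite /d3; real_field; lra.
  have [d0 [d00 H0]] := dL 1%Re ltac:(lra).
  have [d1 [d10 H1]] := dL e1 e10.
  have [d2 [d20 H2]] := dL' e1 e10.
  exists (Rmin (Rmin d0 1) (Rmin (Rmin d1 d2) d3)); split=> [|h Hh].
    by do !apply: Rmin_glb_lt; lra.
  have hd0 : (N h < Rmin d0 1)%Re := Rlt_le_trans _ _ _ Hh (Rmin_l _ _).
  have hd1 : (N h < Rmin (Rmin d1 d2) d3)%Re := Rlt_le_trans _ _ _ Hh (Rmin_r _ _).
  have h1 := Rlt_le_trans _ _ _ hd0 (Rmin_r _ _).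
  have h3 := Rlt_le_trans _ _ _ hd1 (Rmin_r _ _).
  have hd12 := Rlt_le_trans _ _ _ hd1 (Rmin_l _ _).
  have {}H0 := H0 h (Rlt_le_trans _ _ _ hd0 (Rmin_l _ _)).
  have {}H1 := H1 h (Rlt_le_trans _ _ _ hd12 (Rmin_l _ _)).
  have {}H2 := H2 h (Rlt_le_trans _ _ _ hd12 (Rmin_r _ _)).
  set rf := f (p + h) - f p - L h in H0 H1; set rg := g (p + h) - g p - L' h in H2.
  have -> : f (p + h) * g (p + h) - f p * g p - (f p * L' h + g p * L h) =
    (rf + L h) * L' h + ((f p + (rf + L h)) * rg + rf * g p) by rewrite /rf /rg; ring.
  have N0 := N_ge0 h.
  have df : (Cabs (rf + L h) <= (B + 1) * N h)%Re.
    apply: Rle_trans (CabsD _ _) _; have := HB h; lra.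
  have ff : (Cabs (f p + (rf + L h)) <= Cabs (f p) + (B + 1))%Re.
    apply: Rle_trans (CabsD _ _) _; nra.
  have t1 : (Cabs ((rf + L h) * L' h) <= eps / 3 * N h)%Re.
    rewrite CabsM; have := HB' h; have := Cabs_ge0 (L' h); have := Cabs_ge0 (rf + L h).
    move=> c1 c2 c3.
    apply: (Rle_trans _ (((B + 1) * N h) * ((B' + 1) * N h))%Re).
      apply: Rmult_le_compat => //; nra.
    rewrite -d3B; have kN : (0 <= (B + 1) * (B' + 1) * N h)%Re by nra.
    have := Rmult_le_compat_l _ _ _ kN (Rlt_le _ _ h3); lra.
  have t2 : (Cabs ((f p + (rf + L h)) * rg + rf * g p) <= eps / 3 * N h)%Re.
    apply: Rle_trans (CabsD _ _) _; rewrite !CabsM -e1G.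
    have := Cabs_ge0 rg; have := Cabs_ge0 rf; have := Cabs_ge0 (f p + (rf + L h)).
    move=> c1 c2 c3.
    apply: (Rle_trans _ ((Cabs (f p) + (B + 1)) * (e1 * N h) + (e1 * N h) * Cabs (g p))%Re).
      by apply: Rplus_le_compat; apply: Rmult_le_compat => //; lra.
    rewrite /G; have : (0 <= e1 * N h)%Re by nra.
    nra.
  apply: Rle_trans (CabsD _ _) _; nra.
Qed.

End Differentiability.

Lemma Cdiff_at_algebra z : function_algebra (fun g => Cdiff_at g z).
Proof.
pose Lin (L : C -> C) := exists l, forall h, L h = l * h.
apply: (function_algebra_iff (D := diff_at Cabs Lin z)) => [g|].
  split=> [[L [l Ll] HL]|[l Hl]].
    exists l => eps eps0; have [d [d0 Hd]] := HL eps eps0; exists d; split=> // h h0 hd.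
    by rewrite -Ll; apply: Hd.
  exists (fun h => l * h); first by exists l.
  move=> eps eps0; have [d [d0 Hd]] := Hl eps eps0; exists d; split=> // h hd.
  case: (Cabs_ge0 h) => [h0|h0]; first exact: Hd.
  have -> : h = 0 by apply: Cabs_eq0.
  by rewrite addr0 subrr mulr0 subr0 Cabs0; lra.
apply: diff_at_algebra.
- exact: Cabs_ge0.
- move=> L [l Ll]; exists (Cabs l); split; first exact: Cabs_ge0.
  by move=> h; rewrite Ll CabsM; lra.
- by exists 0 => h; rewrite mul0r.
- by move=> L L' [l Ll] [l' Ll']; exists (l + l') => h; rewrite Ll Ll' mulrDl.
- by move=> c L [l Ll]; exists (c * l) => h; rewrite Ll mulrA.
Qed.

Lemma bigR_ge0 (I : Type) (r : seq I) (F : I -> R) :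
  (forall i, 0 <= F i)%Re -> (0 <= \big[Rplus/R0]_(j <- r) F j)%Re.
Proof. by move=> F0; apply: big_ind => //; [lra | move=> *; lra]. Qed.

Lemma bigR_ge_term (I : eqType) (r : seq I) (F : I -> R) i :
  (forall i, 0 <= F i)%Re -> i \in r -> (F i <= \big[Rplus/R0]_(j <- r) F j)%Re.
Proof.
move=> F0; elim: r => // j r IHr; rewrite inE big_cons => /orP[/eqP->|/IHr].
  by have := bigR_ge0 r F0; lra.
by have := F0 j; lra.
Qed.

Lemma mxnorm_ge0 p q (H : 'M[C]_(p, q)) : (0 <= mxnorm H)%Re.
Proof. exact: sqrt_pos. Qed.

Lemma mxnorm_ge_entry p q (H : 'M[C]_(p, q)) i j : (Cabs (H i j) <= mxnorm H)%Re.
Proof.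
apply: sqrt_le_1_alt.
apply: Rle_trans (bigR_ge_term (i := j) (fun l => Cabs2_ge0 (H i l)) (mem_index_enum _)) _.
apply: (bigR_ge_term (F := fun i => \big[Rplus/R0]_(j < q) Cabs2 (H i j)) _ (mem_index_enum i)).
by move=> k; apply: bigR_ge0 => l; apply: Cabs2_ge0.
Qed.

Lemma sum_bounded (T I : Type) (N : T -> R) (r : seq I) (F : I -> T -> C) :
  (forall i, exists B, (0 <= B)%Re /\ forall h, (Cabs (F i h) <= B * N h)%Re) ->
  exists B, (0 <= B)%Re /\ forall h, (Cabs (\sum_(i <- r) F i h) <= B * N h)%Re.
Proof.
move=> HF; elim: r => [|i r [B [B0 HB]]].
  by exists 0%Re; split=> [|h]; rewrite ?big_nil ?Cabs0; lra.
have [B' [B'0 HB']] := HF i; exists (B' + B)%Re; split=> [|h]; first lra.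
rewrite big_cons Rmult_plus_distr_r; apply: Rle_trans (CabsD _ _) _.
exact: Rplus_le_compat.
Qed.

Lemma Cdiff_mx_at_algebra p q (A : 'M[C]_(p, q)) :
  function_algebra (fun phi => Cdiff_mx_at phi A).
Proof.
pose Lin (L : 'M[C]_(p, q) -> C) :=
  exists l : 'M[C]_(p, q), forall H, L H = \sum_(i < p) \sum_(j < q) l i j * H i j.
apply: (function_algebra_iff (D := diff_at (@mxnorm p q) Lin A)) => [g|].
  split=> [[L [l Ll] HL]|[l Hl]].
    by exists l => eps /HL [d [d0 Hd]]; exists d; split=> // h hd; rewrite -Ll; apply: Hd.
  by exists (fun h : 'M[C]_(p, q) => \sum_(i < p) \sum_(j < q) l i j * h i j); first by exists l.
apply: diff_at_algebra.
- exact: mxnorm_ge0.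
- move=> L [l Ll].
  have [i|B [B0 HB]] := @sum_bounded _ _ (@mxnorm p q) (index_enum 'I_p)
    (fun i (H : 'M[C]_(p, q)) => \sum_(j < q) l i j * H i j); last first.
    by exists B; split=> // h; rewrite Ll.
  apply: (@sum_bounded _ _ _ (index_enum 'I_q) (fun j (H : 'M[C]_(p, q)) => l i j * H i j)) => j.
  exists (Cabs (l i j)); split=> [|H]; first exact: Cabs_ge0.
  by rewrite CabsM; apply: Rmult_le_compat_l; [exact: Cabs_ge0 | exact: mxnorm_ge_entry].
- exists 0 => H; rewrite big1 // => i _; rewrite big1 // => j _; by rewrite mxE mul0r.
- move=> L L' [l Ll] [l' Ll']; exists (l + l') => H; rewrite Ll Ll' -big_split.
  apply: eq_bigr => i _; rewrite -big_split; apply: eq_bigr => j _ /=.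
  by rewrite mxE mulrDl.
- move=> c L [l Ll]; exists (c *: l) => H; rewrite Ll mulr_sumr.
  apply: eq_bigr => i _; rewrite mulr_sumr; apply: eq_bigr => j _.
  by rewrite mxE mulrA.
Qed.

Lemma Cdiff_mx_at_entry p q (A : 'M[C]_(p, q)) i j : Cdiff_mx_at (fun B => B i j) A.
Proof.
exists (delta_mx i j) => eps eps0; exists 1%Re; split=> [|H _]; first lra.
have -> : \sum_(k < p) \sum_(l < q) (delta_mx i j : 'M[C]_(p, q)) k l * H k l = H i j.
  rewrite (bigD1 i) //= (bigD1 j) //= mxE !eqxx mul1r big1 ?addr0 => [|l lj].
    rewrite big1 ?addr0 // => k ki; rewrite big1 // => l _.
    by rewrite mxE (negbTE ki) mul0r.
  by rewrite mxE (negbTE lj) andbF mul0r.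
rewrite mxE; have -> : A i j + H i j - A i j - H i j = 0 by ring.
rewrite Cabs0.
by have := mxnorm_ge0 H; nra.
Qed.

Lemma holo_pi_n (m : nat) : holo_pi_entire (@pi_n m).
Proof.
have alg (A : 'M[C]_m.+1) := alg_pi_n (Cdiff_mx_at_algebra A) (F := id) (Cdiff_mx_at_entry A).
by split=> j A; have [H1 H2] := alg A; [exact: H1 | exact: H2].
Qed.

Lemma Cdiff_at_id z : Cdiff_at id z.
Proof.
exists 1 => eps eps0; exists 1%Re; split=> [|h _ _]; first lra.
have -> : id (z + h) - id z - 1 * h = 0 by rewrite /=; ring.
by rewrite Cabs0; have := Cabs_ge0 h; nra.
Qed.

(** * The complex exponential *)

Definition Cexp (z : C) : C := mkC (exp (re z) * cos (im z))%Re (exp (re z) * sin (im z))%Re.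

Arguments Cexp z%R.

Lemma CexpD a b : Cexp (a + b) = Cexp a * Cexp b.
Proof. by apply: C_ext; rewrite /= exp_plus ?cos_plus ?sin_plus; real_ring. Qed.

Lemma Cexp0 : Cexp 0 = 1.
Proof. by apply: C_ext; rewrite /= exp_0 ?cos_0 ?sin_0; real_ring. Qed.

Lemma CexpVl z : Cexp z * Cexp (- z) = 1.
Proof. by rewrite -CexpD subrr Cexp0. Qed.

Lemma derivable_at0 f l : derivable_pt_lim f 0 l -> forall eps, (0 < eps)%Re ->
  exists delta, (0 < delta)%Re /\
    forall h, (Rabs h < delta)%Re -> (Rabs (f h - f 0 - l * h) <= eps * Rabs h)%Re.
Proof.
move=> H eps eps0; have [d Hd] := H eps eps0; exists d; split; first exact: cond_pos.
move=> h hd; case: (Req_dec h 0) => [->|h0].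
  by rewrite Rmult_0_r !Rminus_0_r Rminus_diag Rabs_R0; lra.
have := Hd h h0 hd; rewrite Rplus_0_l => Hh.
have -> : (f h - f 0 - l * h = ((f h - f 0) / h - l) * h)%Re by real_field.
by rewrite Rabs_mult; apply: Rmult_le_compat_r; [exact: Rabs_pos | lra].
Qed.

Lemma Cexp_diff0 eps : (0 < eps)%Re -> exists delta, (0 < delta)%Re /\
  forall h, (Cabs h < delta)%Re -> (Cabs (Cexp h - 1 - h) <= eps * Cabs h)%Re.
Proof.
move=> eps0; pose e := (Rmin (eps / 8) 1)%Re.
have e0 : (0 < e)%Re by apply: Rmin_glb_lt; lra.
have e8 : (e <= eps / 8)%Re := Rmin_l _ _.
have e1 : (e <= 1)%Re := Rmin_r _ _.
have [d1 [d10 H1]] := derivable_at0 (derivable_pt_lim_exp 0) e0.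
have [d2 [d20 H2]] := derivable_at0 derivable_pt_lim_cos_0 e0.
have [d3 [d30 H3]] := derivable_at0 derivable_pt_lim_sin_0 e0.
exists (Rmin (Rmin d1 d2) (Rmin d3 (eps / 8)))%Re; split=> [|h hd].
  by do !apply: Rmin_glb_lt; lra.
have ha := Rlt_le_trans _ _ _ hd (Rmin_l _ _).
have hb := Rlt_le_trans _ _ _ hd (Rmin_r _ _).
have h1 := Rlt_le_trans _ _ _ ha (Rmin_l _ _).
have h2 := Rlt_le_trans _ _ _ ha (Rmin_r _ _).
have h3 := Rlt_le_trans _ _ _ hb (Rmin_l _ _).
have h4 := Rlt_le_trans _ _ _ hb (Rmin_r _ _).
have [hr hi] := (Cabs_re h, Cabs_im h).
have {}H1 := H1 (re h) ltac:(lra); have {}H2 := H2 (im h) ltac:(lra).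
have {}H3 := H3 (im h) ltac:(lra).
rewrite exp_0 Rmult_1_l in H1; rewrite cos_0 Rmult_0_l Rminus_0_r in H2.
rewrite sin_0 Rminus_0_r Rmult_1_l in H3.
have h0 := Cabs_ge0 h.
pose cis := mkC (cos (im h)) (sin (im h)).
have cis1 : Cabs cis = 1%Re.
  by rewrite /Cabs /Cabs2 /= -[RHS]sqrt_1; congr sqrt; have := sin2_cos2 (im h); rewrite /Rsqr; lra.
pose u := mkC (exp (re h) - 1 - re h)%Re 0%Re.
pose w := mkC (cos (im h) - 1)%Re (sin (im h) - im h)%Re.
pose x := mkC (re h) 0%Re; pose y := mkC 0%Re (im h).
(* For [h = x + y] with [x] real and [y] imaginary, the terms are [(e^x - 1 - x) cis], [cis - 1 - y]
   and [x (cis - 1)]. The last is quadratic in [h], which is why the radius also stays below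
   [eps / 8]. *)
have -> : Cexp h - 1 - h = u * cis + (w + x * (w + y)).
  by apply: C_ext; rewrite /=; real_ring.
have cu : (Cabs u <= e * Cabs h)%Re.
  apply: Rle_trans (Cabs_le_re_im _) _; rewrite /= Rabs_R0; nra.
have cw : (Cabs w <= 2 * e * Cabs h)%Re.
  apply: Rle_trans (Cabs_le_re_im _) _; rewrite /=; nra.
have cx : (Cabs x <= Cabs h)%Re.
  apply: Rle_trans (Cabs_le_re_im _) _; rewrite /= Rabs_R0; lra.
have cy : (Cabs y <= Cabs h)%Re.
  apply: Rle_trans (Cabs_le_re_im _) _; rewrite /= Rabs_R0; lra.
have cwy : (Cabs (w + y) <= 3 * Cabs h)%Re by apply: Rle_trans (CabsD _ _) _; nra.
apply: Rle_trans (CabsD _ _) _; rewrite CabsM cis1.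
have t2 : (Cabs (w + x * (w + y)) <= Cabs w + Cabs h * (3 * Cabs h))%Re.
  apply: Rle_trans (CabsD _ _) _; rewrite CabsM.
  apply: Rplus_le_compat_l; apply: Rmult_le_compat => //; exact: Cabs_ge0.
nra.
Qed.

(** The addition formula reduces the chain rule to the derivative of the exponential at 0. *)
Lemma Cdiff_at_Cexp g z : Cdiff_at g z -> Cdiff_at (fun t => Cexp (g t)) z.
Proof.
move=> [l Hl]; exists (Cexp (g z) * l) => eps eps0.
(* The final error is at most [E e (B + 2) |h|], and [K] dominates [E (B + 2)]. The increment of [g]
   is at most [(B + 1) |h|], whence the radius [d2 / (B + 2)]. *)
pose E := Cabs (Cexp (g z)); pose B := Cabs l.
have [E0 B0] : (0 <= E /\ 0 <= B)%Re by split; apply: Cabs_ge0.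
pose K := ((E + 1) * (B + 2))%Re; have K0 : (0 < K)%Re by rewrite /K; nra.
pose e := Rmin (eps / (2 * K)) 1%Re.
have e0 : (0 < e)%Re by apply: Rmin_glb_lt; [apply: Rdiv_lt_0_compat; lra | lra].
have eK : (e * K <= eps / 2)%Re.
  have -> : (eps / 2 = eps / (2 * K) * K)%Re by real_field; lra.
  by apply: Rmult_le_compat_r; [lra | exact: Rmin_l].
have e1 : (e <= 1)%Re := Rmin_r _ _.
have [d1 [d10 H1]] := Hl e e0; have [d2 [d20 H2]] := Cexp_diff0 e0.
have dB : (0 < d2 / (B + 2))%Re by apply: Rdiv_lt_0_compat; lra.
exists (Rmin d1 (d2 / (B + 2)))%Re; split=> [|h h0 hd]; first exact: Rmin_glb_lt.
have {}H1 := H1 h h0 (Rlt_le_trans _ _ _ hd (Rmin_l _ _)).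
have {hd} hd2 := Rlt_le_trans _ _ _ hd (Rmin_r _ _).
have hB : ((B + 2) * Cabs h < d2)%Re.
  have -> : (d2 = (B + 2) * (d2 / (B + 2)))%Re by real_field; lra.
  by apply: Rmult_lt_compat_l; lra.
set k := g (z + h) - g z - l * h in H1.
have kE : g (z + h) = g z + (k + l * h) by rewrite /k; ring.
have ck : (Cabs (k + l * h) <= (B + 1) * Cabs h)%Re.
  apply: Rle_trans (CabsD _ _) _; rewrite CabsM -/B; nra.
have {}H2 := H2 (k + l * h) ltac:(lra).
rewrite kE CexpD.
have -> : Cexp (g z) * Cexp (k + l * h) - Cexp (g z) - Cexp (g z) * l * h =
  Cexp (g z) * ((Cexp (k + l * h) - 1 - (k + l * h)) + k) by ring.
rewrite CabsM -/E.
have c0 : (Cabs (Cexp (k + l * h) - 1 - (k + l * h) + k) <= e * (B + 2) * Cabs h)%Re.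
  apply: Rle_trans (CabsD _ _) _; nra.
have c1 := Rmult_le_compat_l _ _ _ E0 c0.
have : (e * K * Cabs h <= eps / 2 * Cabs h)%Re by apply: Rmult_le_compat_r; lra.
have : (0 <= e * (B + 2) * Cabs h)%Re by do !apply: Rmult_le_pos; lra.
rewrite /K; nra.
Qed.

Lemma Cexp_onto d : d != 0 -> exists s, Cexp s = d.
Proof.
move=> /eqP d0.
have r0 : (0 < Cabs d)%Re by case: (Cabs_ge0 d) => // E; case: d0; apply: Cabs_eq0.
have [th [c s]] : exists th, (Cabs d * cos th = re d /\ Cabs d * sin th = im d)%Re.
  pose x' := (re d / Cabs d)%Re; pose y' := (im d / Cabs d)%Re.
  have xy : (x' * x' + y' * y' = 1)%Re.
    have -> : (x' * x' + y' * y' = Cabs2 d / (Cabs d * Cabs d))%Re.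
      by rewrite /x' /y' /Cabs2; real_field; lra.
    by rewrite Cabs_sqr; apply: Rdiv_diag; rewrite -Cabs_sqr; nra.
  have x1 : (-1 <= x' <= 1)%Re by nra.
  have sq : sqrt (1 - Rsqr x')%Re = Rabs y'.
    by rewrite -(sqrt_Rsqr_abs y'); congr sqrt; rewrite /Rsqr; lra.
  have dx : (Cabs d * x' = re d)%Re by rewrite /x'; real_field; lra.
  have dy : (Cabs d * y' = im d)%Re by rewrite /y'; real_field; lra.
  (* [acos] returns an angle with nonnegative sine; the sign of the imaginary part decides whether
     to negate it. *)
  case: (Rle_lt_dec 0 y') => y0.
    by exists (acos x'); rewrite cos_acos // sin_acos // sq Rabs_pos_eq.
  exists (- acos x')%Re; rewrite cos_neg sin_neg cos_acos // sin_acos // sq Rabs_left //.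
  by rewrite Ropp_involutive.
exists (mkC (ln (Cabs d)) th); apply: C_ext; by rewrite /= exp_ln.
Qed.

(** * Interpolation in the general linear group *)

Definition entire (g : C -> C) := forall z, Cdiff_at g z.

Lemma entire_algebra : function_algebra entire.
Proof.
split=> [c|f g Df Dg|f g Df Dg] z.
- exact: (alg_cst (Cdiff_at_algebra z)).
- exact: (alg_add (Cdiff_at_algebra z)).
- exact: (alg_mul (Cdiff_at_algebra z)).
Qed.

Section Interpolation.

Variables (M : nat) (zeta : 'I_M -> C).
Hypothesis zeta_inj : injective zeta.

Lemma lagrange_basis j : exists p : {poly C},
  p.[zeta j] = 1 /\ forall i, i != j -> p.[zeta i] = 0.
Proof.
exists (\prod_(i | i != j) ((zeta j - zeta i)^-1 *: ('X - (zeta i)%:P))); split.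
  rewrite horner_prod big1 // => i ij; rewrite !hornerE mulVf // subr_eq0.
  by apply: contra ij => /eqP/zeta_inj ->.
move=> i ij; rewrite horner_prod (bigD1 i) //=.
by rewrite !hornerE subrr mulr0 mul0r.
Qed.

(** The value 1 at the other nodes makes these maps multiply without disturbing each other. [H]
    carries the inverse along as an entire function. *)
Definition interpolable (k : nat) (j : 'I_M) (K : 'M[C]_k) :=
  exists G H : C -> 'M[C]_k,
    [/\ alg_mx entire G, alg_mx entire H, forall z, G z *m H z = 1%:M,
        G (zeta j) = K & forall i, i != j -> G (zeta i) = 1%:M].

Lemma interpolable1 k j : interpolable j (1%:M : 'M[C]_k).
Proof.
exists (fun=> 1%:M), (fun=> 1%:M); split=> // [||z]; last by rewrite mulmx1.
- exact: (alg_mx_cst entire_algebra).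
- exact: (alg_mx_cst entire_algebra).
Qed.

Lemma interpolableM k j (K K' : 'M[C]_k) :
  interpolable j K -> interpolable j K' -> interpolable j (K *m K').
Proof.
move=> [G [H [eG eH GH Gj Gi]]] [G' [H' [eG' eH' GH' Gj' Gi']]].
exists (fun z => G z *m G' z), (fun z => H' z *m H z); split.
- exact: (alg_mulmx entire_algebra).
- exact: (alg_mulmx entire_algebra).
- by move=> z; rewrite mulmxA -(mulmxA (G z)) GH' mulmx1.
- by rewrite Gj Gj'.
- by move=> i ij; rewrite Gi // Gi' // mulmx1.
Qed.

(** With [p] the Lagrange polynomial of node [j], [1 + p(z) N] has inverse [1 - p(z) N]. *)
Lemma interpolable_unipotent k j (N : 'M[C]_k) : N *m N = 0 -> interpolable j (1%:M + N).
Proof.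
move=> NN; have [p [pj pi]] := lagrange_basis j.
have ep c : alg_mx entire (fun z => 1%:M + (c * p.[z]) *: N).
  move=> a b; apply: (@alg_eq _ entire (fun z => (1%:M : 'M[C]_k) a b + (c * p.[z]) * N a b)).
    by move=> z; rewrite [RHS]mxE [X in _ = _ + X]mxE.
  apply: (alg_add entire_algebra); first exact: (alg_cst entire_algebra).
  apply: (alg_mul entire_algebra); last exact: (alg_cst entire_algebra).
  apply: (alg_mul entire_algebra); first exact: (alg_cst entire_algebra).
  exact: (alg_horner entire_algebra p (f := id) Cdiff_at_id).
exists (fun z => 1%:M + (1 * p.[z]) *: N), (fun z => 1%:M + (-1 * p.[z]) *: N).
split; [exact: ep | exact: ep | | |].
- move=> z; rewrite mulmxDl mul1mx mulmxDr mulmx1 -scalemxAl -scalemxAr NN !scaler0 addr0.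
  by rewrite mul1r mulN1r scaleNr -addrA addNr addr0.
- by rewrite pj mulr1 scale1r.
- by move=> i ij; rewrite pi // mulr0 scale0r addr0.
Qed.

Lemma interpolable_block k j (K : 'M[C]_k) :
  interpolable j K -> interpolable j (block_mx 1%:M 0 0 K : 'M[C]_(1 + k)).
Proof.
move=> [G [H [eG eH GH Gj Gi]]].
exists (fun z => block_mx 1%:M 0 0 (G z)), (fun z => block_mx 1%:M 0 0 (H z)); split.
- by apply: alg_block_mx => //; apply: (alg_mx_cst entire_algebra).
- by apply: alg_block_mx => //; apply: (alg_mx_cst entire_algebra).
- move=> z; rewrite mulmx_block !mul0mx !mulmx0 mulmx1 !addr0 add0r GH.
  by rewrite -scalar_mx_block.
- by rewrite Gj.
- by move=> i ij; rewrite Gi // -scalar_mx_block.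
Qed.

(** Unipotent factors have determinant 1, so the determinant must come from here: [exp (s p(z))]
    with [exp s = d] has the required values and never vanishes. *)
Lemma interpolable_diag1 k j (d : C) : d != 0 ->
  interpolable j (block_mx d%:M 0 0 1%:M : 'M[C]_(1 + k)).
Proof.
move=> d0; have [s Es] := Cexp_onto d0; have [p [pj pi]] := lagrange_basis j.
have ep c : alg_mx entire (fun z => (Cexp (c * p.[z]))%:M : 'M[C]_1).
  move=> a b z; apply: (@alg_eq _ (fun g => Cdiff_at g z) (fun z => Cexp (c * p.[z]))) => [t|].
    by rewrite !ord1 mxE eqxx.
  apply: Cdiff_at_Cexp; apply: (alg_mul (Cdiff_at_algebra z)).
    exact: (alg_cst (Cdiff_at_algebra z)).
  exact: (alg_horner (Cdiff_at_algebra z) p (f := id) (Cdiff_at_id z)).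
exists (fun z => block_mx (Cexp (s * p.[z]))%:M 0 0 1%:M),
       (fun z => block_mx (Cexp (- s * p.[z]))%:M 0 0 1%:M); split.
- by apply: alg_block_mx => //; apply: (alg_mx_cst entire_algebra).
- by apply: alg_block_mx => //; apply: (alg_mx_cst entire_algebra).
- move=> z; rewrite mulmx_block !mul0mx !mulmx0 mulmx1 !addr0 add0r.
  by rewrite -scalar_mxM mulNr CexpVl -scalar_mx_block.
- by rewrite pj mulr1 Es.
- by move=> i ij; rewrite pi // mulr0 Cexp0 -scalar_mx_block.
Qed.

Lemma interpolable_lblock k j (c : 'cV[C]_k) :
  interpolable j (block_mx 1%:M 0 c 1%:M : 'M[C]_(1 + k)).
Proof.
have -> : block_mx 1%:M 0 c 1%:M = 1%:M + block_mx 0 0 c 0 :> 'M[C]_(1 + k).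
  by rewrite scalar_mx_block add_block_mx !addr0 !add0r.
apply: interpolable_unipotent.
by rewrite mulmx_block !mul0mx !mulmx0 !addr0 block_mx_const.
Qed.

Lemma interpolable_ublock k j (b : 'rV[C]_k) :
  interpolable j (block_mx 1%:M b 0 1%:M : 'M[C]_(1 + k)).
Proof.
have -> : block_mx 1%:M b 0 1%:M = 1%:M + block_mx 0 b 0 0 :> 'M[C]_(1 + k).
  by rewrite scalar_mx_block add_block_mx !addr0 !add0r.
apply: interpolable_unipotent.
by rewrite mulmx_block !mul0mx !mulmx0 !addr0 block_mx_const.
Qed.

(* Gaussian elimination writes K as a product of the preceding matrices *)
Lemma interpolable_unitmx k j (K : 'M[C]_k) : K \in unitmx -> interpolable j K.
Proof.
elim: k K => [|k IHk] K uK.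
  have -> : K = 1%:M by rewrite [LHS]flatmx0 [RHS]flatmx0.
  exact: interpolable1.
have pivot (a : C) (b : 'rV_k) (c : 'cV_k) (D : 'M_k) : a != 0 ->
    (block_mx a%:M b c D : 'M[C]_(1 + k)) \in unitmx ->
    interpolable j (block_mx a%:M b c D : 'M[C]_(1 + k)).
  (* [S] is the Schur complement of the pivot, and the product below is the block LDU
     factorization. *)
  move=> a0; pose S := D - a^-1 *: (c *m b).
  have -> : block_mx a%:M b c D = block_mx 1%:M 0 (a^-1 *: c) 1%:M
     *m (block_mx a%:M 0 0 1%:M *m block_mx 1%:M 0 0 S)
     *m block_mx 1%:M (a^-1 *: b) 0 1%:M :> 'M_(1 + k).
    rewrite !mulmx_block !mul0mx !mulmx0 !mulmx1 !mul1mx !addr0 !add0r.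
    rewrite mul_scalar_mx mul_mx_scalar !scalerA !mulfV // !scale1r -scalemxAr.
    by rewrite mulmx0 add0r /S addrC subrK.
  rewrite !unitmx_mul => /andP[/andP[_ /andP[_ uS]] _].
  apply: interpolableM; last exact: interpolable_ublock.
  apply: interpolableM; first exact: interpolable_lblock.
  apply: interpolableM; first exact: interpolable_diag1.
  apply/interpolable_block/IHk.
  by move: uS; rewrite !unitmxE det_lblock det1 mul1r.
rewrite -[K](@submxK _ 1 k 1 k).
set a := ulsubmx _; set b := ursubmx _; set c := dlsubmx _; set D := drsubmx _.
have Ea : a = (a ord0 ord0)%:M by rewrite [LHS]mx11_scalar.
have {}uK : (block_mx a b c D : 'M_(1 + k)) \in unitmx by rewrite submxK.
case: (eqVneq (a ord0 ord0) 0) => a0; last by rewrite Ea; apply: pivot => //; rewrite -Ea.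
have [i ci] : exists i, c i ord0 != 0.
  apply/existsP; rewrite -negb_forall; apply/negP => /forallP c0.
  move: uK; rewrite unitmxE.
  have -> : c = 0 by apply/colP=> i; rewrite [RHS]mxE; apply/eqP.
  by rewrite det_ublock Ea a0 det_scalar expr1 mul0r unitr0.
(* A zero pivot is repaired by adding row [i] of the lower block to the first row, which brings
   [c i] into the corner. The operation undoing this is again unipotent. *)
pose e := delta_mx ord0 i : 'rV[C]_k.
have eN : block_mx 1%:M (- e) 0 1%:M *m block_mx 1%:M e 0 1%:M = 1%:M :> 'M[C]_(1 + k).
  by rewrite mulmx_block !mul0mx !mulmx0 !mulmx1 !mul1mx !addr0 !add0r addrN -scalar_mx_block.
rewrite -[block_mx a b c D]mul1mx -eN -mulmxA.
apply: interpolableM; first exact: interpolable_ublock.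
have uE : (block_mx 1%:M e 0 1%:M *m block_mx a b c D : 'M_(1 + k)) \in unitmx.
  by rewrite unitmx_mul uK andbT unitmxE det_ublock !det1 mulr1 unitr1.
rewrite mulmx_block !mul0mx !mul1mx !add0r in uE *.
have Ec : a + e *m c = (c i ord0)%:M.
  rewrite Ea a0 -rowE; apply/matrixP=> x y; rewrite !ord1 !mxE eqxx !mulr1n ?mul0rn ?add0r.
  by [].
by rewrite Ec in uE *; apply: pivot.
Qed.

Lemma interpolate_unitmx k (K : 'I_M -> 'M[C]_k) : (forall j, K j \in unitmx) ->
  exists G H : C -> 'M[C]_k,
    [/\ alg_mx entire G, alg_mx entire H, forall z, G z *m H z = 1%:M &
        forall j, G (zeta j) = K j].
Proof.
move=> uK.
(* Stated for a list of nodes, with value 1 at the nodes not yet treated, so that the induction can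
   add them one at a time. *)
suff [G [H [eG eH GH Gj]]] : exists G H : C -> 'M[C]_k,
    [/\ alg_mx entire G, alg_mx entire H, forall z, G z *m H z = 1%:M &
        forall j, G (zeta j) = if j \in enum 'I_M then K j else 1%:M].
  by exists G, H; split=> // j; rewrite Gj mem_enum.
elim: (enum 'I_M) (enum_uniq 'I_M) => [_|j s IHs /= /andP[js us]].
  exists (fun=> 1%:M), (fun=> 1%:M); split=> // [||z]; last by rewrite mulmx1.
  - exact: (alg_mx_cst entire_algebra).
  - exact: (alg_mx_cst entire_algebra).
have [G [H [eG eH GH Gs]]] := IHs us.
have [G' [H' [eG' eH' GH' Gj Gi]]] := interpolable_unitmx j (uK j).
exists (fun z => G z *m G' z), (fun z => H' z *m H z); split.
- exact: (alg_mulmx entire_algebra).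
- exact: (alg_mulmx entire_algebra).
- by move=> z; rewrite mulmxA -(mulmxA (G z)) GH' mulmx1.
- move=> i; rewrite inE Gs; case: eqVneq => [->|ij] /=.
    by rewrite (negbTE js) Gj mul1mx.
  by rewrite Gi // mulmx1.
Qed.

End Interpolation.

(** * The domain and its quotient *)

(** The bound on [g t] is included because products need it. The distance enters through any common
    bound [delta] on the coordinates, so no norm on [I -> C] is required. *)
Definition locally_lipschitz (I : Type) (g : (I -> C) -> C) :=
  forall M : R, exists B : R, (0 <= B)%Re /\
    forall (t t' : I -> C) (delta : R), (0 <= delta)%Re ->
      (forall i, Cabs (t i) <= M)%Re -> (forall i, Cabs (t' i) <= M)%Re ->
      (forall i, Cabs (t i - t' i) <= delta)%Re ->
      (Cabs (g t) <= B)%Re /\ (Cabs (g t - g t') <= B * delta)%Re.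

Lemma locally_lipschitz_algebra (I : Type) : function_algebra (@locally_lipschitz I).
Proof.
split=> [c|f g Hf Hg|f g Hf Hg] M.
- exists (Cabs c); split=> [|t t' d d0 _ _ _]; first exact: Cabs_ge0.
  rewrite subrr Cabs0; have := Cabs_ge0 c; split; nra.
- have [B [B0 HB]] := Hf M; have [B' [B'0 HB']] := Hg M.
  exists (B + B')%Re; split=> [|t t' d d0 tM t'M tt']; first lra.
  have [b1 b2] := HB t t' d d0 tM t'M tt'; have [b1' b2'] := HB' t t' d d0 tM t'M tt'.
  split; first by apply: Rle_trans (CabsD _ _) _; lra.
  have -> : f t + g t - (f t' + g t') = (f t - f t') + (g t - g t') by ring.
  by apply: Rle_trans (CabsD _ _) _; lra.
- have [B [B0 HB]] := Hf M; have [B' [B'0 HB']] := Hg M.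
  exists (2 * (B * B'))%Re; split=> [|t t' d d0 tM t'M tt']; first nra.
  have [b1 b2] := HB t t' d d0 tM t'M tt'; have [b1' b2'] := HB' t t' d d0 tM t'M tt'.
  have b3 : (Cabs (g t') <= B')%Re.
    apply: (proj1 (HB' t' t d d0 t'M tM _)) => i.
    by rewrite -CabsN opprB.
  have BB : (0 <= B * B')%Re by nra.
  have m1 : (Cabs (f t) * Cabs (g t) <= B * B')%Re.
    by apply: Rmult_le_compat => //; apply: Cabs_ge0.
  have m2 : (Cabs (f t) * Cabs (g t - g t') <= B * (B' * d))%Re.
    by apply: Rmult_le_compat => //; apply: Cabs_ge0.
  have m3 : (Cabs (f t - f t') * Cabs (g t') <= B * d * B')%Re.
    by apply: Rmult_le_compat => //; apply: Cabs_ge0.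
  split; first by rewrite CabsM; lra.
  have -> : f t * g t - f t' * g t' = f t * (g t - g t') + (f t - f t') * g t' by ring.
  by apply: Rle_trans (CabsD _ _) _; rewrite !CabsM; lra.
Qed.

Lemma locally_lipschitz_coord (I : Type) (i : I) : locally_lipschitz (fun t => t i).
Proof.
move=> M; exists (Rmax 1 M); split=> [|t t' d d0 tM t'M tt'].
  by have := Rmax_l 1 M; lra.
split; first by apply: Rle_trans (tM i) (Rmax_r _ _).
by have := Rmax_l 1 M; have := tt' i; nra.
Qed.

(** Each point of R^4 gets its own margin: near a point outside the closed bidisc some coordinate
    stays away from the unit disc, and near a point of the bidisc [g] has no zero. Compactness makes
    the margin uniform. *)
Lemma zero_free_margin (g : (bool -> C) -> C) : locally_lipschitz g ->
  (forall t, (forall i, Cabs (t i) <= 1)%Re -> g t <> 0) ->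
  exists r, (1 < r)%Re /\ forall t, g t = 0 -> exists i, (r <= Cabs (t i))%Re.
Proof.
move=> lg g0.
pose pt (p : Compactness.Tn 4 R) : bool -> C := let: (a, (b, (c, (d, _)))) := p in
  fun i => if i then mkC a b else mkC c d.
have local p : exists delta : posreal, forall t,
    (forall i, Rabs (re (t i) - re (pt p i)) < delta /\ Rabs (im (t i) - im (pt p i)) < delta)%Re ->
    g t = 0 -> exists i, (1 + delta <= Cabs (t i))%Re.
  have near t (delta : R) :
    (forall i, Rabs (re (t i) - re (pt p i)) < delta /\ Rabs (im (t i) - im (pt p i)) < delta)%Re ->
    forall i, (Cabs (pt p i - t i) <= 2 * delta)%Re.
    move=> Ht i; rewrite -CabsN opprB; apply: Rle_trans (Cabs_le_re_im _) _.
    rewrite reD imD reN imN; case: (Ht i); rewrite /Rminus; lra.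
  case: (excluded_middle_informative (exists i, 1 < Cabs (pt p i))%Re) => [[i Hi]|Hin].
    have d0 : (0 < (Cabs (pt p i) - 1) / 3)%Re by lra.
    exists (mkposreal _ d0) => t /= Ht _; exists i.
    have := near _ _ Ht i; have := CabsD (pt p i - t i) (t i); rewrite subrK; lra.
  have Hp i : (Cabs (pt p i) <= 1)%Re.
    by apply: Rnot_lt_le => Hi; apply: Hin; exists i.
  have eta0 : (0 < Cabs (g (pt p)))%Re.
    by case: (Cabs_ge0 (g (pt p))) => // E; case: (g0 _ Hp); apply: Cabs_eq0.
  have [B [B0 HB]] := lg 3%Re.
  pose d := Rmin 1 (Cabs (g (pt p)) / (4 * (B + 1)))%Re.
  have dq : (0 < Cabs (g (pt p)) / (4 * (B + 1)))%Re by apply: Rdiv_lt_0_compat; lra.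
  have d0 : (0 < d)%Re by apply: Rmin_glb_lt; lra.
  have d1 : (d <= 1)%Re := Rmin_l _ _.
  have dB : (d * (4 * (B + 1)) <= Cabs (g (pt p)))%Re.
    have -> : (Cabs (g (pt p)) = Cabs (g (pt p)) / (4 * (B + 1)) * (4 * (B + 1)))%Re.
      by real_field; lra.
    by apply: Rmult_le_compat_r; [lra | exact: Rmin_r].
  exists (mkposreal _ d0) => t /= Ht gt0; exfalso.
  have {}near := near _ _ Ht.
  have tM i : (Cabs (t i) <= 3)%Re.
    have -> : t i = pt p i - (pt p i - t i) by ring.
    by apply: Rle_trans (CabsB _ _) _; have := near i; have := Hp i; lra.
  have pM i : (Cabs (pt p i) <= 3)%Re by have := Hp i; lra.
  have [_] := HB (pt p) t (2 * d)%Re ltac:(lra) pM tM near.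
  by rewrite gt0 subr0; nra.
pose delta p := proj1_sig (constructive_indefinite_description _ (local p)).
have Hdelta p := proj2_sig (constructive_indefinite_description _ (local p)).
pose lo : Compactness.Tn 4 R := ((-2)%Re, ((-2)%Re, ((-2)%Re, ((-2)%Re, tt)))).
pose hi : Compactness.Tn 4 R := (2%Re, (2%Re, (2%Re, (2%Re, tt)))).
have [d Hd] := Compactness.compactness_value 4 lo hi delta.
have d0 := cond_pos d.
exists (Rmin 2 (1 + d))%Re; split; first by apply: Rmin_glb_lt; lra.
move=> t gt0; apply: Classical_Prop.NNPP => Hn.
have t2 i : (Cabs (t i) < 2)%Re.
  apply: Rnot_le_lt => ti; apply: Hn; exists i; apply: Rle_trans ti; exact: Rmin_l.
have box (x : R) i : (Rabs x <= Cabs (t i))%Re -> (-2 <= x <= 2)%Re.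
  by move=> Hx; have := t2 i; move: Hx; rewrite /Rabs; case: Rcase_abs; lra.
pose p : Compactness.Tn 4 R :=
  (re (t true), (im (t true), (re (t false), (im (t false), tt)))).
apply: (Hd p).
  split; first exact: box (Cabs_re (t true)).
  split; first exact: box (Cabs_im (t true)).
  split; first exact: box (Cabs_re (t false)).
  by split; first exact: box (Cabs_im (t false)).
move=> [q [_ [Hq dq]]]; apply: Hn.
have [|i Hi] := Hdelta q t _ gt0.
  case: q Hq {dq} => a [b [c [e []]]] /= [h1 [h2 [h3 [h4 _]]]].
  by case.
exists i; apply: Rle_trans Hi; apply: Rle_trans (Rmin_r _ _) _.
rewrite -/(delta q); lra.
Qed.

HB.instance Definition _ := Monoid.isComLaw.Build R R0 Rplus
  (fun x y z => esym (Rplus_assoc x y z)) Rplus_comm Rplus_0_l.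

Lemma le_vnorm k (u v : 'cV[C]_k) :
  (forall i, Cabs (u i ord0) <= Cabs (v i ord0))%Re -> (vnorm u <= vnorm v)%Re.
Proof.
move=> uv; apply: sqrt_le_1_alt.
apply: (big_ind2 (fun x y => x <= y)%Re) => [|x x' y y'|i _]; [lra|lra|].
rewrite -!Cabs_sqr; apply: Rmult_le_compat => //; exact: Cabs_ge0.
Qed.

Lemma vnorm_ge_entry k (v : 'cV[C]_k) i : (Cabs (v i ord0) <= vnorm v)%Re.
Proof.
apply: sqrt_le_1_alt; apply: (bigR_ge_term (F := fun i => Cabs2 (v i ord0))).
  by move=> j; apply: Cabs2_ge0.
exact: mem_index_enum.
Qed.

Lemma vnorm_delta k (i : 'I_k) : vnorm (delta_mx i ord0) = 1%Re.
Proof.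
rewrite /vnorm (bigD1 i) //= big1 => [|j ji]; rewrite mxE ?eqxx /=.
  by rewrite -[RHS]sqrt_1; congr sqrt; rewrite /Cabs2 /=; real_ring.
by rewrite (negbTE ji) /Cabs2 /=; real_ring.
Qed.

Definition E1n_mx k (z w : C) : 'M[C]_k :=
  \matrix_(i, j) (if i == j then (if (i : nat) == 0%N then w else z) else 0).

Lemma E1n_mx_mulv k z w (v : 'cV[C]_k) i :
  (E1n_mx k z w *m v) i ord0 = (if (i : nat) == 0%N then w else z) * v i ord0.
Proof.
rewrite mxE (bigD1 i) //= big1 ?addr0 => [|j ji]; first by rewrite mxE eqxx.
by rewrite mxE eq_sym (negbTE ji) mul0r.
Qed.

Lemma Omega1nP (m : nat) (A : 'M[C]_m.+1) : (0 < m)%N -> Omega1n A <-> G1n (pi_n A).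
Proof.
move=> m0.
have singE z w : (1%:M - A *m E1n_mx m.+1 z w \notin unitmx) =
    (Qn (piY A) z - w * Pn (piX A) z == 0).
  by rewrite unitmxE unitfE negbK det_1_sub_mul.
split=> [[r [r1 Hr]] z w Dz Dw|G].
  apply/negP; rewrite -singE => sing.
  have bnd (v : 'cV[C]_m.+1) : (vnorm v <= 1)%Re -> (vnorm (E1n_mx m.+1 z w *m v) <= 1)%Re.
    move=> v1; apply: Rle_trans v1; apply: le_vnorm => i.
    rewrite E1n_mx_mulv CabsM; have := Cabs_ge0 (v i ord0).
    by case: ifP => _; [move: Dw | move: Dz]; rewrite /inDbar; nra.
  pose S r := exists v : 'cV[C]_m.+1, (vnorm v <= 1)%Re /\ r = vnorm (E1n_mx m.+1 z w *m v).
  have [||s Hs] := completeness S.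
  - by exists 1%Re => x [v [v1 ->]]; apply: bnd.
  - exists (vnorm (E1n_mx m.+1 z w *m (delta_mx ord0 ord0))), (delta_mx ord0 ord0).
    by split=> //; rewrite vnorm_delta; lra.
  have := Hr (E1n_mx m.+1 z w) (ex_intro _ z (ex_intro _ w erefl)) sing s Hs.
  have : (s <= 1)%Re by apply: (proj2 Hs) => x [v [v1 ->]]; apply: bnd.
  lra.
pose g (t : bool -> C) := (Qpoly (piY A)).[t true] - t false * (Ppoly (piX A)).[t true].
have [||r [r1 Hr]] := @zero_free_margin g.
- have alg := locally_lipschitz_algebra bool.
  have lc i := @locally_lipschitz_coord bool i.
  have lh p := alg_horner alg p (lc true).
  exact: (alg_add alg (lh _) (alg_opp alg (alg_mul alg (lc false) (lh _)))).
- move=> t t1; apply/eqP; rewrite /g horner_Qpoly horner_Ppoly; apply: (G); exact: t1.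
exists r; split=> // X [z [w ->]]; rewrite singE => /eqP sing s [Hs _].
have [|i] := Hr (fun i => if i then z else w).
  by rewrite /g horner_Qpoly horner_Ppoly.
have key j : (Cabs (if ((j : 'I_m.+1) : nat) == 0%N then w else z) <= s)%Re.
  apply: Rle_trans (Hs _ _); last first.
    by exists (delta_mx j ord0); split; last reflexivity; rewrite vnorm_delta; lra.
  have := vnorm_ge_entry (E1n_mx m.+1 z w *m delta_mx j ord0) j.
  by rewrite E1n_mx_mulv mxE !eqxx mulr1.
case: i => ri; first by have := key (Ordinal (m0 : (1 < m.+1)%N)) => /=; lra.
by have := key ord0 => /=; lra.
Qed.

(** * Null sets *)

Section AlgebraicClosure.

Import complex Rstruct.

Let toRi (z : C) : complex R := Complex (re z) (im z).

Let toRi_zmod : zmod_morphism toRi. Proof. by move=> a b. Qed.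
Let toRi_monoid : monoid_morphism toRi. Proof. by split=> [|a b]. Qed.

HB.instance Definition _ := GRing.isZmodMorphism.Build C (complex R) toRi toRi_zmod.
HB.instance Definition _ := GRing.isMonoidMorphism.Build C (complex R) toRi toRi_monoid.

Lemma C_closed (p : {poly C}) : size p != 1 -> exists x, root p x.
Proof.
move=> sp; have /closed_rootP[[x y]] : size (map_poly toRi p) != 1 by rewrite size_map_poly.
by rewrite -[Complex x y]/(toRi (mkC x y)) fmorph_root; exists (mkC x y).
Qed.

End AlgebraicClosure.

Lemma left_eigenvector_of_noncyclic (m : nat) (X : 'M[C]_m.+1) (v : 'cV[C]_m.+1) :
  ~~ cyclic_vector X v ->
  exists theta (lam : 'rV[C]_m.+1), [/\ lam != 0, lam *m X = theta *: lam & lam *m v = 0].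
Proof.
move=> ncyc; pose U (mu : 'rV[C]_m.+1) := forall p, mu *m horner_mx X p *m v = 0.
have [mu mu0 Umu] : exists2 mu, mu != 0 & U mu.
  pose K := Krylov X v.
  have : kermx K^T != 0.
    rewrite kermx_eq0 row_free_unit unitmx_tr -row_full_unit; exact: ncyc.
  case/rowV0Pn=> mu /sub_kermxP muK mu0; exists mu => // p.
  have muX (i : 'I_m.+1) : mu *m X ^+ i *m v = 0.
    have := congr1 (fun B : 'rV_m.+1 => B ord0 i) muK; rewrite [RHS]mxE => E.
    apply/matrixP=> a b; rewrite !ord1 [RHS]mxE -[RHS]E -mulmxA [LHS]mxE [RHS]mxE.
    by apply: eq_bigr => j _; rewrite [K^T _ _]mxE [K _ _]mxE.
  rewrite (divp_eq p (char_poly X)) rmorphD rmorphM /= Cayley_Hamilton mulr0 add0r.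
  set r := p %% _; have sr : (size r <= m.+1)%N.
    rewrite -ltnS -(size_char_poly X) ltn_modp -size_poly_eq0 size_char_poly //.
  rewrite -[r]coefK poly_def rmorph_sum /= mulmx_sumr mulmx_suml big1 // => i _.
  rewrite linearZ /= rmorphXn /= horner_mx_X -scalemxAr -scalemxAl.
  have lti : (i < m.+1)%N by apply: leq_trans sr.
  by rewrite (muX (Ordinal lti)) scaler0.
have [f f0 muf] : exists2 f : {poly C}, f != 0 & mu *m horner_mx X f = 0.
  exists (char_poly X); first by rewrite -size_poly_eq0 size_char_poly.
  by rewrite Cayley_Hamilton mulmx0.
move: {2}(size f) (leqnn (size f)) => d.
elim: d f f0 mu mu0 Umu muf => [|d IHd] f f0 mu mu0 Umu muf sf.
  by rewrite -size_poly_eq0 -leqn0 sf in f0.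
case: (eqVneq (size f) 1%N) => [/eqP/size_poly1P[c c0 Ef]|/C_closed[theta]].
  case/eqP: mu0; move: muf; rewrite Ef horner_mx_C mul_mx_scalar => /eqP.
  by rewrite scaler_eq0 (negbTE c0) => /eqP.
case/factor_theorem=> g Ef.
have g0 : g != 0 by apply: contraNneq f0 => g0; rewrite Ef g0 mul0r.
case: (eqVneq (mu *m horner_mx X g) 0) => [mug|mug].
  apply: (IHd g g0 mu mu0 Umu mug).
  by move: sf; rewrite Ef size_Mmonic ?monicXsubC // size_XsubC addn2.
exists theta, (mu *m horner_mx X g); split=> //.
  apply/eqP; rewrite -subr_eq0; apply/eqP; rewrite -muf Ef rmorphM rmorphB /=.
  by rewrite horner_mx_X horner_mx_C mulmxA mulmxBr mul_mx_scalar.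
Qed.

Lemma null_set_sub k (S S' : 'M[C]_k -> Prop) :
  (forall A, S A -> S' A) -> null_set S' -> null_set S.
Proof.
move=> sub null eps eps0; have [lo [hi [ok [cov vol]]]] := null eps eps0.
by exists lo, hi; split=> //; split=> // A /sub; apply: cov.
Qed.

Lemma sum_f_R0_big (f : nat -> R) N : sum_f_R0 f N = \big[Rplus/R0]_(n < N.+1) f n.
Proof.
elim: N => [|N IHN] /=; first by rewrite big_ord_recl big_ord0 /=; lra.
by rewrite IHN [RHS]big_ord_recr.
Qed.

Lemma bigR_le (I : Type) (r : seq I) (P : pred I) (F G : I -> R) :
  (forall i, F i <= G i)%Re ->
  (\big[Rplus/R0]_(i <- r | P i) F i <= \big[Rplus/R0]_(i <- r | P i) G i)%Re.
Proof.
move=> FG; apply: (big_ind2 (fun x y => x <= y)%Re) => [|x x' y y'|i _]; [lra|lra|exact: FG].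
Qed.

Lemma sum_Cantor_le (V : nat -> nat -> R) B : (forall i l, 0 <= V i l)%Re ->
  (\big[Rplus/R0]_(n < B) V (Cantor.of_nat n).1 (Cantor.of_nat n).2 <=
   \big[Rplus/R0]_(i < B) \big[Rplus/R0]_(l < B) V i l)%Re.
Proof.
move=> V0; case: B => [|B]; first by rewrite !big_ord0; lra.
have bnd (n : 'I_B.+1) : ((Cantor.of_nat n).1 < B.+1)%N && ((Cantor.of_nat n).2 < B.+1)%N.
  have := Cantor.to_nat_non_decreasing (Cantor.of_nat n).1 (Cantor.of_nat n).2.
  rewrite -surjective_pairing Cantor.cancel_to_of => /leP le.
  have := ltn_ord n; rewrite !ltnS => nB.
  by apply/andP; split; apply: leq_trans nB; apply: leq_trans le;
    rewrite plusE ?leq_addl ?leq_addr.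
pose c (n : 'I_B.+1) : 'I_B.+1 * 'I_B.+1 :=
  (inord (Cantor.of_nat n).1, inord (Cantor.of_nat n).2).
have c_inj : injective c.
  move=> n n' [/(congr1 val) E1 /(congr1 val) E2]; apply: val_inj => /=.
  have /andP[a1 a2] := bnd n; have /andP[b1 b2] := bnd n'.
  rewrite /= !inordK // in E1; rewrite /= !inordK // in E2.
  rewrite -(Cantor.cancel_to_of n) -(Cantor.cancel_to_of n').
  by rewrite [Cantor.of_nat n]surjective_pairing [Cantor.of_nat n']surjective_pairing E1 E2.
rewrite pair_big /=.
have -> : \big[Rplus/R0]_(n < B.+1) V (Cantor.of_nat n).1 (Cantor.of_nat n).2 =
    \big[Rplus/R0]_(p in c @: setT) V p.1 p.2.
  rewrite big_imset => [|x y _ _]; last exact: c_inj.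
  apply: eq_big => [n|n _]; first by rewrite inE.
  by have /andP[a1 a2] := bnd n; rewrite /= !inordK.
rewrite [X in (_ <= X)%Re](bigID (fun p => p \in c @: setT)) /=.
have : (0 <= \big[Rplus/R0]_(p : 'I_B.+1 * 'I_B.+1 | p \notin c @: setT) V p.1 p.2)%Re.
  apply: (big_ind (fun x => 0 <= x)%Re) => [||p _]; [lra | move=> *; lra | exact: V0].
by set x := bigop _ _ _; set y := bigop _ _ _; lra.
Qed.

Lemma bigR_mul_ge0 k (F : 'I_k -> R) : (forall i, 0 <= F i)%Re ->
  (0 <= \big[Rmult/R1]_(i < k) F i)%Re.
Proof.
move=> F0; apply: (big_ind (fun x => 0 <= x)%Re) => [||i _]; last exact: F0.
  lra.
exact: Rmult_le_pos.
Qed.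

Lemma box_vol_ge0 k (lo hi : 'M[C]_k) : box_ok lo hi -> (0 <= box_vol lo hi)%Re.
Proof.
move=> ok; apply: bigR_mul_ge0 => i; apply: bigR_mul_ge0 => j.
by have [? ?] := ok i j; apply: Rmult_le_pos; lra.
Qed.

Lemma geometric_lt B : (\big[Rplus/R0]_(i < B) (/ 2) ^ i.+1 < 1)%Re.
Proof.
suff -> : (\big[Rplus/R0]_(i < B) (/ 2) ^ i.+1 = 1 - (/ 2) ^ B)%Re.
  by have := pow_lt (/ 2) B; lra.
elim: B => [|B IHB]; first by rewrite big_ord0 /=; lra.
by rewrite big_ord_recr /= IHB; lra.
Qed.

Lemma null_set_union k (S : nat -> 'M[C]_k -> Prop) :
  (forall i, null_set (S i)) -> null_set (fun A => exists i, S i A).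
Proof.
move=> null eps eps0.
have e0 i : (0 < eps * (/ 2) ^ i.+1)%Re.
  by apply: Rmult_lt_0_compat => //; apply: pow_lt; lra.
pose lo i := proj1_sig (constructive_indefinite_description _ (null i _ (e0 i))).
have Hlo i : exists hi, (forall l, box_ok (lo i l) (hi l)) /\
    (forall A, S i A -> exists l, in_box (lo i l) (hi l) A) /\
    (forall N, sum_f_R0 (fun l => box_vol (lo i l) (hi l)) N < eps * (/ 2) ^ i.+1)%Re.
  exact: (proj2_sig (constructive_indefinite_description _ (null i _ (e0 i)))).
pose hi i := proj1_sig (constructive_indefinite_description _ (Hlo i)).
have Hhi i := proj2_sig (constructive_indefinite_description _ (Hlo i)).
rewrite -/(hi _) in Hhi.
have ok i l := (Hhi i).1 l.
exists (fun n => lo (Cantor.of_nat n).1 (Cantor.of_nat n).2),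
       (fun n => hi (Cantor.of_nat n).1 (Cantor.of_nat n).2).
split; first by move=> n; apply: ok.
split=> [A [i Si]|N].
  have [l Hl] := (Hhi i).2.1 A Si.
  by exists (Cantor.to_nat (i, l)); rewrite Cantor.cancel_of_to.
rewrite sum_f_R0_big.
have := @sum_Cantor_le (fun i l => box_vol (lo i l) (hi i l)) N.+1
  (fun i l => box_vol_ge0 (ok i l)).
move/Rle_lt_trans; apply.
apply: (Rle_lt_trans _ (\big[Rplus/R0]_(i < N.+1) (eps * (/ 2) ^ i.+1))%Re).
  by apply: bigR_le => i; have := (Hhi i).2.2 N; rewrite sum_f_R0_big; apply: Rlt_le.
have -> : (\big[Rplus/R0]_(i < N.+1) (eps * (/ 2) ^ i.+1) =
           eps * \big[Rplus/R0]_(i < N.+1) (/ 2) ^ i.+1)%Re.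
  apply: (big_ind2 (fun x y => x = eps * y)%Re) => [|x x' y y' -> ->|//]; lra.
by have := geometric_lt N.+1; nra.
Qed.

Lemma grid_cell N (h x : R) : (0 < N)%N -> (0 <= x <= INR N * h)%Re ->
  exists a : 'I_N, (INR a * h <= x <= INR a * h + h)%Re.
Proof.
elim: N => // N IHN _; rewrite S_INR => Hx.
case: N IHN Hx => [|N] IHN Hx.
  by exists ord0; move: Hx => /=; lra.
case: (Rle_lt_dec x (INR N.+1 * h)) => xN.
  have [//||a Ha] := IHN; first lra.
  by exists (widen_ord (leqnSn _) a).
by exists ord_max; rewrite -[nat_of_ord ord_max]/(N.+1); lra.
Qed.

Lemma bigR_mul_const k (c : R) : (\big[Rmult/R1]_(i < k) c = c ^ k)%Re.
Proof.
elim: k => [|k IHk]; first by rewrite big_ord0.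
by rewrite big_ord_recl IHk.
Qed.

Lemma null_set_lipschitz_image (I : finType) k (phi : (I -> C) -> 'M[C]_k.+1) (M : nat) :
  (#|I| < k.+1 * k.+1)%N ->
  (forall i j, locally_lipschitz (fun t => phi t i j)) ->
  null_set (fun A => exists2 t : I -> C,
    (forall i, Rabs (re (t i)) <= INR M /\ Rabs (im (t i)) <= INR M)%Re & A = phi t).
Proof.
move=> dimI lip eps eps0; set Mr := INR M; have Mr0 : (0 <= Mr)%Re by apply: pos_INR.
have [B [B0 HB]] : exists B, (0 <= B)%Re /\ forall i j (t t' : I -> C) d, (0 <= d)%Re ->
    (forall l, Cabs (t l) <= 2 * Mr)%Re -> (forall l, Cabs (t' l) <= 2 * Mr)%Re ->
    (forall l, Cabs (t l - t' l) <= d)%Re -> (Cabs (phi t i j - phi t' i j) <= B * d)%Re.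
  have E (p : 'I_k.+1 * 'I_k.+1) := lip p.1 p.2 (2 * Mr)%Re.
  pose b p := proj1_sig (constructive_indefinite_description _ (E p)).
  have Hb p := proj2_sig (constructive_indefinite_description _ (E p)).
  rewrite -/(b _) in Hb.
  exists (\big[Rplus/R0]_(p : 'I_k.+1 * 'I_k.+1) b p); split.
    by apply: bigR_ge0 => p; case: (Hb p).
  move=> i j t t' d d0 tM t'M tt'.
  apply: Rle_trans (proj2 ((Hb (i, j)).2 t t' d d0 tM t'M tt')) _.
  apply: Rmult_le_compat_r => //; apply: bigR_ge_term (mem_index_enum _) => p.
  by case: (Hb p).
pose K := (4 * (4 * Mr * B) * (4 * Mr * B))%Re.
have MB : (0 <= Mr * B)%Re by exact: Rmult_le_pos.
have K0 : (0 <= K)%Re by rewrite /K; nra.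
pose q := (k.+1 * k.+1)%N.
have Kq0 : (0 <= K ^ q)%Re by apply: pow_le.
have [N HN] := INR_unbounded (K ^ q / eps)%Re.
have Ke0 : (0 <= K ^ q / eps)%Re.
  by apply: Rmult_le_pos => //; apply/Rlt_le/Rinv_0_lt_compat.
have N0 : (0 < N)%N by case: N HN => [|N] // HN; exfalso; rewrite [INR 0]/(IZR 0) in HN; lra.
have N1 : (1 <= INR N)%Re by apply: (le_INR 1); apply/leP.
pose h := (2 * Mr / INR N)%Re.
have h0 : (0 <= h)%Re by apply: Rmult_le_pos; [lra | apply/Rlt_le/Rinv_0_lt_compat; lra].
have Nh : (INR N * h = 2 * Mr)%Re by rewrite /h; real_field; lra.
pose G : finType := {ffun I -> 'I_N * 'I_N}.
pose corner (g : G) (i : I) : C := mkC (INR (g i).1 * h - Mr)%Re (INR (g i).2 * h - Mr)%Re.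
have corner_le (a : 'I_N) : (Rabs (INR a * h - Mr) <= Mr)%Re.
  have a0 := pos_INR a; have aN : (INR a <= INR N)%Re by apply/le_INR/leP/ltnW.
  have : (INR a * h <= INR N * h)%Re by apply: Rmult_le_compat_r.
  have : (0 <= INR a * h)%Re by apply: Rmult_le_pos.
  by rewrite Nh /Rabs; case: Rcase_abs; lra.
pose rho := (B * (2 * h))%Re.
have rho0 : (0 <= rho)%Re by apply: Rmult_le_pos; lra.
pose lo g : 'M[C]_k.+1 := \matrix_(i, j) (phi (corner g) i j + mkC (- rho)%Re (- rho)%Re).
pose hi g : 'M[C]_k.+1 := \matrix_(i, j) (phi (corner g) i j + mkC rho rho).
pose v := ((2 * rho * (2 * rho)) ^ q)%Re.
have v0 : (0 <= v)%Re by apply: pow_le; nra.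
have vol g : box_vol (lo g) (hi g) = v.
  rewrite /box_vol /v /q.
  under eq_bigr => i _ do under eq_bigr => j _ do rewrite !mxE !reD !imD /=.
  have E (x y : R) : Rmult (Rminus (x + rho)%Re (x + - rho)%Re) (Rminus (y + rho)%Re (y + - rho)%Re)
    = (2 * rho * (2 * rho))%Re by real_ring.
  under eq_bigr => i _ do under eq_bigr => j _ do rewrite E.
  under eq_bigr => i _ do rewrite bigR_mul_const.
  by rewrite bigR_mul_const -pow_mult.
pose lo' l : 'M[C]_k.+1 := if insub l is Some u then lo (enum_val (u : 'I_#|G|)) else 0.
pose hi' l : 'M[C]_k.+1 := if insub l is Some u then hi (enum_val (u : 'I_#|G|)) else 0.
exists lo', hi'; split; [|split].
- move=> l i j; rewrite /lo' /hi'; case: insubP => [u _ _|_]; last by lra.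
  by rewrite !mxE !reD !imD /=; lra.
- move=> A [t tM ->].
  have cell (x : R) : (Rabs x <= Mr)%Re -> exists a : 'I_N,
      (Rabs (x - (INR a * h - Mr)) <= h)%Re.
    move=> xM; have [|a Ha] := @grid_cell N h (x + Mr) N0.
      by rewrite Nh; move: xM; rewrite /Rabs; case: Rcase_abs; lra.
    by exists a; rewrite /Rabs; case: Rcase_abs; lra.
  have cells i : exists a : 'I_N * 'I_N, (Rabs (re (t i) - (INR a.1 * h - Mr)) <= h /\
      Rabs (im (t i) - (INR a.2 * h - Mr)) <= h)%Re.
    have [a Ha] := cell _ (tM i).1; have [b Hb] := cell _ (tM i).2.
    by exists (a, b).
  pose g : G := [ffun i => proj1_sig (constructive_indefinite_description _ (cells i))].
  have Hg i : (Rabs (re (t i - corner g i)) <= h /\ Rabs (im (t i - corner g i)) <= h)%Re.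
    rewrite reD imD reN imN /= ffunE.
    exact: (proj2_sig (constructive_indefinite_description _ (cells i))).
  have close i j : (Cabs (phi t i j - phi (corner g) i j) <= rho)%Re.
    apply: HB => [|l|l|l]; first lra.
    - by apply: Rle_trans (Cabs_le_re_im _) _; have := tM l; lra.
    - apply: Rle_trans (Cabs_le_re_im _) _; rewrite /=.
      by apply: Rle_trans (Rplus_le_compat _ _ _ _ (corner_le (g l).1) (corner_le (g l).2)) _; lra.
    - by apply: Rle_trans (Cabs_le_re_im _) _; have := Hg l; lra.
  exists (enum_rank g); rewrite /lo' /hi' [insub _](valK (enum_rank g)) enum_rankK => i j.
  rewrite !mxE !reD !imD /=.
  have [c1 c2] := (Cabs_re (phi t i j - phi (corner g) i j),
                   Cabs_im (phi t i j - phi (corner g) i j)).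
  have cij := close i j.
  rewrite reD reN in c1; rewrite imD imN in c2.
  by move: c1 c2; rewrite /Rabs; do 2![case: Rcase_abs]; lra.
move=> L; rewrite sum_f_R0_big.
have Hvol l : box_vol (lo' l) (hi' l) = if (l < #|G|)%N then v else 0%Re.
  rewrite /lo' /hi'; case: insubP => [u -> _|/negbTE ->]; first exact: vol.
  rewrite /box_vol.
  under eq_bigr => i _ do under eq_bigr => j _ do rewrite Rminus_diag Rmult_0_l.
  under eq_bigr => i _ do rewrite bigR_mul_const /= Rmult_0_l.
  by rewrite bigR_mul_const /= Rmult_0_l.
under eq_bigr => l _ do rewrite Hvol.
apply: (Rle_lt_trans _ (INR #|G| * v)).
  suff H n : (\big[Rplus/R0]_(l < n) (if (l < #|G|)%N then v else 0) <= INR (minn n #|G|) * v)%Re.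
    apply: Rle_trans (H _) _; apply: Rmult_le_compat_r => //; apply/le_INR/leP; exact: geq_minr.
  move: #|G| => c; elim: n => [|n IHn]; first by rewrite big_ord0 min0n /=; lra.
  rewrite big_ord_recr /=; case: ltnP IHn => nG IHn.
    by rewrite (minn_idPl nG) S_INR Rmult_plus_distr_r Rmult_1_l; apply: Rplus_le_compat_r.
  by rewrite (minn_idPr (leqW nG)) Rplus_0_r.
have INR_expn a b : INR (a ^ b)%N = (INR a ^ b)%Re.
  by elim: b => [|b IHb] //; rewrite expnS mult_INR IHb.
pose X := (INR N * INR N)%Re; have X1 : (INR N <= X)%Re by rewrite /X; nra.
have -> : INR #|G| = (X ^ #|I|)%Re.
  by rewrite card_ffun card_prod card_ord INR_expn mult_INR.
have Eq : (q = #|I| + (q - #|I|).-1.+1)%N by rewrite prednK ?subn_gt0 // subnKC // ltnW.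
have EvK : v = (K ^ q * (/ X) ^ q)%Re.
  rewrite /v -Rpow_mult_distr; congr (_ ^ _)%Re.
  by rewrite /rho /h /K /X; real_field; lra.
have iX0 : (0 < / X)%Re by apply: Rinv_0_lt_compat; lra.
have iXN : (/ X <= / INR N)%Re by apply: Rinv_le_contravar; lra.
have iX1 : (/ X <= 1)%Re by rewrite -Rinv_1; apply: Rinv_le_contravar; lra.
have key : (X ^ #|I| * (/ X) ^ q <= / INR N)%Re.
  rewrite [in X in (_ * X)%Re]Eq pow_add -Rmult_assoc -Rpow_mult_distr.
  rewrite Rinv_r ?pow1 ?Rmult_1_l /=; last lra.
  have pX1 : ((/ X) ^ (q - #|I|).-1 <= 1)%Re.
    by rewrite -(pow1 (q - #|I|).-1); apply: pow_incr; lra.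
  apply: Rle_trans iXN; rewrite -[X in (_ <= X)%Re]Rmult_1_r.
  by apply: Rmult_le_compat_l => //; apply: Rlt_le.
apply: (Rle_lt_trans _ (K ^ q * / INR N)%Re).
  rewrite EvK.
  have -> : (X ^ #|I| * (K ^ q * (/ X) ^ q) = K ^ q * (X ^ #|I| * (/ X) ^ q))%Re by real_ring.
  exact: Rmult_le_compat_l.
have : (K ^ q / eps * eps < INR N * eps)%Re by apply: Rmult_lt_compat_r.
have -> : (K ^ q / eps * eps = K ^ q)%Re by real_field; lra.
move=> H; have := Rmult_lt_compat_r _ _ _ (Rinv_0_lt_compat (INR N) ltac:(lra)) H.
have -> : (INR N * eps * / INR N = eps)%Re by real_field; lra.
by [].
Qed.

Section NoncyclicParametrization.

Variables (m : nat) (i : 'I_m).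

Definition free_entry := {p : 'I_m.+1 * 'I_m.+1 | p != (lift ord0 i, ord0)}.

Definition entry_of (t : free_entry -> C) (p : 'I_m.+1 * 'I_m.+1) : C :=
  if insub p is Some u then t u else 0.

(* In [t], the row i of the block Ah is replaced by a left eigenvector lam of Ah with lam_i = 1,
   where the eigenvalue theta takes the place of lam_i; the row i of [c, Ah] is then recovered
   from lam Ah = theta lam and lam c = 0. *)
Definition eigen_lam t (j : 'I_m) : C :=
  if j == i then 1 else entry_of t (lift ord0 i, lift ord0 j).

Definition noncyclic_mx (t : free_entry -> C) : 'M[C]_m.+1 :=
  \matrix_(r, s)
    if r == lift ord0 i then
      (if unlift ord0 s is Some j then
         entry_of t (lift ord0 i, lift ord0 i) * eigen_lam t j else 0)
      - \sum_(l | l != i) eigen_lam t l * entry_of t (lift ord0 l, s)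
    else entry_of t (r, s).

Lemma noncyclic_mx_lipschitz r s : locally_lipschitz (fun t => noncyclic_mx t r s).
Proof.
have alg := locally_lipschitz_algebra free_entry.
have le p : locally_lipschitz (fun t => entry_of t p).
  rewrite /entry_of; case: insub => [u|]; first exact: locally_lipschitz_coord.
  exact: (alg_cst alg).
have ll j : locally_lipschitz (fun t => eigen_lam t j).
  by rewrite /eigen_lam; case: (j == i); [exact: (alg_cst alg) | exact: le].
apply: (@alg_eq _ (@locally_lipschitz _) (fun t => if r == lift ord0 i then
      (if unlift ord0 s is Some j then
         entry_of t (lift ord0 i, lift ord0 i) * eigen_lam t j else 0)
      - \sum_(l | l != i) eigen_lam t l * entry_of t (lift ord0 l, s)
    else entry_of t (r, s))) => [t|]; first by rewrite mxE.
case: (r == _); last exact: le.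
apply: (alg_add alg (f := fun t => if unlift ord0 s is Some j then
         entry_of t (lift ord0 i, lift ord0 i) * eigen_lam t j else 0)).
  case: (unlift ord0 s) => [j|]; last exact: (alg_cst alg).
  exact: (alg_mul alg (le _) (ll _)).
by apply: (alg_opp alg); apply: (alg_sum alg) => l _; exact: (alg_mul alg (ll _) (le _)).
Qed.

Lemma card_free_entry : (#|{: free_entry}| < m.+1 * m.+1)%N.
Proof.
rewrite card_sig (cardC1 (lift ord0 i, ord0)) card_prod card_ord.
by rewrite prednK.
Qed.

Lemma noncyclic_mx_onto (A : 'M[C]_m.+1) theta (lam : 'rV[C]_m) :
  lam ord0 i = 1 -> lam *m hatmx A = theta *: lam -> lam *m firstcol_tail A = 0 ->
  exists t, A = noncyclic_mx t.
Proof.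
move=> lam1 eig lamc.
pose t (u : free_entry) : C := let: (r, s) := val u in
  if r == lift ord0 i then
    (if unlift ord0 s is Some j then if j == i then theta else lam ord0 j else 0)
  else A r s.
have tE r s : (r, s) != (lift ord0 i, ord0) -> entry_of t (r, s) =
    if r == lift ord0 i then
      (if unlift ord0 s is Some j then if j == i then theta else lam ord0 j else 0)
    else A r s.
  by move=> rs; rewrite /entry_of insubT.
have lamE j : eigen_lam t j = lam ord0 j.
  rewrite /eigen_lam; case: eqVneq => [->|ji]; first by rewrite lam1.
  by rewrite tE ?eqxx ?liftK ?(negbTE ji) // xpair_eqE eqxx.
have otherE l s : l != i -> entry_of t (lift ord0 l, s) = A (lift ord0 l) s.
  by move=> li; rewrite tE ?xpair_eqE (inj_eq lift_inj) (negbTE li).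
exists t; apply/matrixP=> r s; rewrite [RHS]mxE; case: eqVneq => [->|ri]; last first.
  by rewrite tE ?(negbTE ri) // xpair_eqE (negbTE ri).
have -> : \sum_(l | l != i) eigen_lam t l * entry_of t (lift ord0 l, s) =
   \sum_l lam ord0 l * A (lift ord0 l) s - A (lift ord0 i) s.
  rewrite [in RHS](bigD1 i) //= lam1 mul1r [RHS]addrAC subrr add0r.
  by apply: eq_bigr => l li; rewrite lamE otherE.
rewrite opprB addrCA -[LHS]addr0; congr (_ + _); apply/eqP; rewrite eq_sym subr_eq0; apply/eqP.
case: (unliftP ord0 s) => [j|] ->.
  rewrite lamE tE ?xpair_eqE ?eqxx ?liftK ?eqxx //.
  have := congr1 (fun B : 'rV_m => B ord0 j) eig; rewrite !mxE => <-.
  by apply: eq_bigr => l _; rewrite mxE.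
have E := congr1 (fun B : 'M_1 => B ord0 ord0) lamc; rewrite !mxE in E.
rewrite -[LHS]E.
by apply: eq_bigr => l _; rewrite mxE.
Qed.

End NoncyclicParametrization.

Lemma null_set_noncyclic (m' : nat) :
  null_set (fun A : 'M[C]_m'.+2 => ~~ cyclic_vector (hatmx A) (firstcol_tail A)).
Proof.
have null : null_set (fun A : 'M[C]_m'.+2 => exists i M : nat,
    exists2 t : free_entry (inord i : 'I_m'.+1) -> C,
      (forall u, Rabs (re (t u)) <= INR M /\ Rabs (im (t u)) <= INR M)%Re & A = noncyclic_mx t).
  apply: null_set_union => i; apply: null_set_union => M.
  apply: null_set_lipschitz_image; first exact: card_free_entry.
  by move=> r s; apply: noncyclic_mx_lipschitz.
apply: null_set_sub null => A /left_eigenvector_of_noncyclic[theta [lam [/rV0Pn[i li] eig lamc]]].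
exists i; rewrite inord_val.
have [|||t ->] := @noncyclic_mx_onto _ i A theta ((lam ord0 i)^-1 *: lam).
- by rewrite mxE mulVf.
- by rewrite -scalemxAl eig scalerA mulrC -scalerA.
- by rewrite -scalemxAl lamc scaler0.
pose b u := (Rabs (re (t u)) + Rabs (im (t u)))%Re.
have b0 u : (0 <= b u)%Re.
  by apply: Rplus_le_le_0_compat; apply: Rabs_pos.
have [M HM] := INR_unbounded (\big[Rplus/R0]_(u : free_entry i) b u).
exists M, t => // u; have : (b u <= INR M)%Re.
  by apply/Rlt_le/Rle_lt_trans/HM; apply: bigR_ge_term (mem_index_enum u).
rewrite /b /=; have := Rabs_pos (re (t u)); have := Rabs_pos (im (t u)); lra.
Qed.

Theorem theorem1 (m : nat) (hm : (1 <= m)%N) :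
  (* (1) *)
  null_set (fun A : 'M[C]_m.+1 => Omega1n A /\ ~ Omega1n_tilde A)
  /\
  (* (2) *)
  (holo_pi_entire (@pi_n m)
   /\ (forall A : 'M[C]_m.+1, Omega1n A -> G1n (pi_n A))
   /\ (forall xy : 'rV[C]_m.+1 * 'rV[C]_m, G1n xy ->
         exists A : 'M[C]_m.+1, Omega1n A /\ pi_n A = xy))
  /\
  (* (3) *)
  (forall (M : nat) (zeta : 'I_M -> C) (W : 'I_M -> 'M[C]_m.+1),
     injective zeta -> (forall j, inD (zeta j)) ->
     (forall j, Omega1n_tilde (W j)) ->
     ((exists F : C -> 'M[C]_m.+1,
         holo_mx_D F /\ (forall z, inD z -> Omega1n (F z)) /\
         (forall j, F (zeta j) = W j))
      <->
      (exists f : C -> 'rV[C]_m.+1 * 'rV[C]_m,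
         holo_pair_D f /\ (forall z, inD z -> G1n (f z)) /\
         (forall j, f (zeta j) = pi_n (W j))))).
Proof.
case: m hm => // m' hm; split; [|split; [split; [|split]|]].
- apply: null_set_sub (null_set_noncyclic m') => A [OA nOA]; apply/negP => cyc.
  by apply: nOA; split=> //; split=> //; exists (firstcol_tail A).
- exact: holo_pi_n.
- by move=> A /Omega1nP; apply.
- move=> xy Gxy; exists (canonical_mx xy).
  by rewrite Omega1nP // pi_canonical_mx.
move=> M zeta W zeta_inj Dz OW; split=> [[F [holF [OF FW]]]|[f [[holx holy] [Gf fW]]]].
  exists (fun z => pi_n (F z)); split; [|split=> [z Dz'|j]]; last by rewrite FW.
    have DF z (zD : inD z) : alg_mx (fun g => Cdiff_at g z) F by move=> i j; exact: holF.
    by split=> i j z zD; have [H1 H2] := alg_pi_n (Cdiff_at_algebra z) (DF z zD);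
      [exact: H1 | exact: H2].
  by apply/Omega1nP => //; apply: OF.
have conjW j : exists KK : 'M[C]_m'.+1 * 'M[C]_m'.+1,
    KK.2 *m KK.1 = 1%:M /\ W j = conj1 KK.1 KK.2 (canonical_mx (pi_n (W j))).
  have [K [K' [KK' WE]]] := cyclic_canonical (OW j).2.2.
  by exists (K, K').
pose KK j := proj1_sig (constructive_indefinite_description _ (conjW j)).
have HKK j : (KK j).2 *m (KK j).1 = 1%:M /\
    W j = conj1 (KK j).1 (KK j).2 (canonical_mx (pi_n (W j))).
  exact: (proj2_sig (constructive_indefinite_description _ (conjW j))).
clearbody KK.
have [|G [H [eG eH GH GK]]] := @interpolate_unitmx M zeta zeta_inj _ (fun j => (KK j).1).
  by move=> j; case/mulmx1_unit: (HKK j).1.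
exists (fun z => conj1 (G z) (H z) (canonical_mx (f z))); split; [|split=> [z zD|j]].
- move=> i j z zD; have alg := Cdiff_at_algebra z.
  have Dblock (B : C -> 'M[C]_m'.+1) : alg_mx entire B -> alg_mx (fun g => Cdiff_at g z)
      (fun t => block_mx 1%:M 0 0 (B t) : 'M[C]_(1 + m'.+1)).
    by move=> eB; apply: alg_block_mx => [||| k l]; try exact: (alg_mx_cst alg); apply: eB.
  have DA : alg_mx (fun g => Cdiff_at g z) (fun t => canonical_mx (f t)).
    by apply: (alg_canonical_mx alg) => k l; [exact: holx | exact: holy].
  exact: (alg_mulmx alg (alg_mulmx alg (Dblock G eG) DA) (Dblock H eH)).
- apply/Omega1nP => //; rewrite pi_n_conj1 // pi_canonical_mx; exact: Gf.
have [KKj WE] := HKK j; rewrite fW GK [RHS]WE; congr (conj1 _ _ _).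
by rewrite -[RHS]mulmx1 -(GH (zeta j)) GK mulmxA KKj mul1mx.
Qed.
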